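(* Let $\mathfrak A$ be projective and spanning, let $\mathfrak c$ be a chamber containing $\kappa$ in its closure, and let $P$ be a homogeneous polynomial of degree $d=n-r$ in $n$ variables. Let $Z[\mathfrak c]$ be a (compact) cycle contained in $U(\mathfrak A)\cap\{u\in\mathfrak a_{\mathbb C}:|\kappa(u)|<1\}$ and representing $h(\mathfrak c)$ in $U(\mathfrak A)$. Fix a $\mathfrak c$-positive basis $\lambda_1,\dots,\lambda_r\in\Gamma_{\mathfrak a}$, and assume that $z\in(\mathbb C^* )^n$ is such that $|q_j|<\min_{u\in Z[\mathfrak c]}|p_j(u)|$ for $j=1,\dots,r$, where $q_j=z^{\lambda_j}$ and $p_j=p_{\lambda_j}$. Then $$\langle P\rangle_{\mathfrak A,\mathfrak c}(z)=\frac1{(2\pi\sqrt{-1})^r}\int_{Z[\mathfrak c]}\frac{P(\alpha_1,\dots,\alpha_n)\prod_{j=1}^rp_j\;d\mu}{(1-\kappa)\prod_{i=1}^n\alpha_i\prod_{j=1}^r(p_j-q_j)}.$$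
   Context: Setting. $\mathfrak a$ is an oriented real vector space of dimension $r$ with a full rank lattice $\Gamma_{\mathfrak a}$, $\Gamma_{\mathfrak a}^*\subset\mathfrak a^*$ the dual lattice, $\mathfrak A=[\alpha_1,\dots,\alpha_n]$ a sequence in $\Gamma_{\mathfrak a}^*$ (repetitions allowed) generating $\Gamma_{\mathfrak a}^*$ over $\mathbb Z$, $\kappa=\sum_i\alpha_i$. $\mathfrak A$ is projective if it lies in an open (linear) half space; spanning if for every $k$ one can write $\kappa=\sum_it_i\alpha_i$ with $t_i\ge0$, $t_k=0$, $t_i\ne0$ for $i\ne k$. $U(\mathfrak A)=\{u\in\mathfrak a_{\mathbb C}:\alpha_i(u)\ne0\ \forall i\}$; $d\mu$ is the translation invariant holomorphic volume form on $\mathfrak a_{\mathbb C}$ determined by the orientation and $\Gamma_{\mathfrak a}$ (signed unit volume on a fundamental parallelepiped). Chambers. For an index set $\sigma$ such that $\boldsymbol\gamma^\sigma=(\alpha_i)_{i\in\sigma}$ is a basis of $\mathfrak a^*$, let $\mathrm{Cone}(\boldsymbol\gamma^\sigma)$ be the closed cone it spans. Chambers are the connected components of the closed cone $\mathrm{Cone}(\mathfrak A)$ minus the union of the boundaries of all the cones $\mathrm{Cone}(\boldsymbol\gamma^\sigma)$. $\bar{\mathfrak c}^\perp=\{\lambda\in\mathfrak a:\langle\xi,\lambda\rangle\ge0\ \forall\xi\in\mathfrak c\}$. The class $h(\mathfrak c)$. $\mathbb C_{\mathfrak A}[\mathfrak a]$ is the space of rational functions on $\mathfrak a_{\mathbb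 C}$ whose denominators are products of powers of elements of $\mathfrak A$. $\mathrm{JK}_{\mathfrak c}$ is the (well defined) linear functional on $\mathbb C_{\mathfrak A}[\mathfrak a]$ such that $\mathrm{JK}_{\mathfrak c}(1/\prod_{i\in\sigma}\alpha_i)$ equals $|\mathrm{vol}(\boldsymbol\gamma^\sigma)|^{-1}$ if $\mathfrak c\subset\mathrm{Cone}(\boldsymbol\gamma^\sigma)$ and $0$ otherwise (volume of the spanned parallelepiped in units of $\Gamma_{\mathfrak a}^*$), and which vanishes on functions of homogeneous degree $\neq-r$ and on fractions whose denominator consists of linear forms not spanning $\mathfrak a^*$. $h(\mathfrak c)\in H_r(U(\mathfrak A),\mathbb R)$ is the class with $\mathrm{JK}_{\mathfrak c}(f)=(2\pi\sqrt{-1})^{-r}\int_{h(\mathfrak c)}f\,d\mu$ for all $f\in\mathbb C_{\mathfrak A}[\mathfrak a]$. Generating series. For $\lambda\in\Gamma_{\mathfrak a}$: $p_\lambda(u)=\prod_i\alpha_i(u)^{\langle\alpha_i,\lambda\rangle}$, $z^\lambda=\prod_iz_i^{\langle\alpha_i,\lambda\rangle}$, $$\langle P\rangle_{\lambda,\mathfrak A,\mathfrak c}=\frac1{(2\pi\sqrt{-1})^r}\int_{Z}\frac{P(\alpha_1,\dots,\alpha_n)\,d\mu}{(1-\kappa)p_\lambda\prod_i\alpha_i}$$ for any cycle $Z\subset U(\mathfrak A)\cap\{|\kappa(u)|<1\}$ representing $h(\mathfrak c)$ (independent of $Z$), and $\langle P\rangle_{\mathfrak A,\mathfrak c}(z)=\sum_{\lambda\in\Gamma_{\mathfrak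 a}\cap\bar{\mathfrak c}^\perp}\langle P\rangle_{\lambda,\mathfrak A,\mathfrak c}z^\lambda$. A set $\{\lambda_1,\dots,\lambda_r\}\subset\Gamma_{\mathfrak a}$ is a $\mathfrak c$-positive basis if $\sum_j\mathbb Z\lambda_j=\Gamma_{\mathfrak a}$, $\sum_j\mathbb R_{\ge0}\lambda_j\supset\bar{\mathfrak c}^\perp$, and $\langle\kappa,\lambda_j\rangle\ge0$ for all $j$. *)

(* Defs.v *)
From HB Require Import structures.
From mathcomp Require Import all_boot all_order all_algebra.
From mathcomp Require Import finmap complex.
From mathcomp Require Import mpoly.
From mathcomp Require Import all_classical all_reals all_analysis.

Set Implicit Arguments.
Unset Strict Implicit.
Unset Printing Implicit Defensive.

Import Order.TTheory GRing.Theory Num.Theory.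
Import numFieldNormedType.Exports.

Local Open Scope classical_set_scope.
Local Open Scope complex_scope.
Local Open Scope ring_scope.

(* The oriented vector space with its full rank lattice is given by a finite
   dimensional space [a] and a basis [g] of it: the lattice is the Z-span of
   [g], and the orientation is the one for which [g] is positive.  Every full
   rank lattice in an oriented space has such a basis, and everything below
   depends on [g] only through the lattice and the orientation. *)

Definition zspan (V : zmodType) (k : nat) (v : k.-tuple V) : set V :=
  [set x | exists m : 'I_k -> int, x = \sum_i tnth v i *~ m i].

Definition ccone (R : realType) (V : vectType R) (k : nat) (v : k.-tuple V) :
    set V :=
  [set x | exists2 t : 'I_k -> R,
     (forall i, 0 <= t i) & x = \sum_i t i *: tnth v i].

(* Convergence of the unordered sum of [f] over [D] to [s] (equivalently,
   absolute convergence with sum [s]). *)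
Definition has_sum (R : realType) (I : choiceType) (D : set I)
    (f : I -> R[i]) (s : R[i]) : Prop :=
  forall eps : R, 0 < eps ->
  exists2 F0 : {fset I}, {in F0, forall i, D i} &
    forall F : {fset I}, {subset F0 <= F} -> {in F, forall i, D i} ->
      `|\sum_(i <- F) f i - s| < eps%:C.

Section Lattice.
Context {R : realType} {a : vectType R} {r : nat} (g : r.-tuple a).
Local Notation dual := 'Hom(a, R^o).

Definition lattice : set a := zspan g.

Definition dual_lattice : set dual :=
  [set xi : dual | forall v, lattice v -> (xi v : R) \is a Num.int].

(* The usual topology of the finite dimensional space [a^*], transported along
   its linear identification with R^r. *)
Definition dual_coord (xi : dual) : 'rV[R]_r := \row_j (xi (tnth g j) : R).
Definition dual_top := initial_topology dual_coord.

(* The complexification of [a] is [a * a], with (x, y) standing for x + iy. *)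
Definition cplx : Type := (a * a)%type.

Definition cplx_scale (t : R[i]) (u : cplx) : cplx :=
  (complex.Re t *: u.1 - complex.Im t *: u.2, complex.Im t *: u.1 + complex.Re t *: u.2).

Definition cform (xi : dual) (u : cplx) : R[i] :=
  (xi u.1 : R) +i* (xi u.2 : R).

Definition ccoord (j : 'I_r) (u : cplx) : R[i] :=
  coord g j u.1 +i* coord g j u.2.

End Lattice.

Arguments cplx {R} a.

(* Real C^1 singular cubical chains.  A singular k-cube is a C^1 map on the
   cube [0,1]^k; it is represented by a C^1 extension to R^k, of which only the
   restriction to the cube is ever used. *)
Section Chains.
Context {R : realType} {a : vectType R}.
Local Notation dual := 'Hom(a, R^o).

Definition ucube (k : nat) : set 'rV[R]_k :=
  [set t | forall j, 0 <= t 0 j <= 1].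

Definition C1 (k : nat) (f : 'rV[R]_k -> R) : Prop :=
  (forall t, differentiable f t) /\
  (forall v : 'rV[R]_k, continuous (fun t => 'D_v f t)).

Definition C1_cube (k : nat) (s : 'rV[R]_k -> cplx a) : Prop :=
  forall xi : dual,
    C1 (fun t => xi (s t).1 : R) /\ C1 (fun t => xi (s t).2 : R).

Definition cchain (k : nat) := seq (R * ('rV[R]_k -> cplx a)).

Definition carrier (k : nat) (Z : cchain k) : set (cplx a) :=
  [set u | exists2 x, x \in Z & exists2 t, ucube t & u = x.2 t].

Definition chain_in (k : nat) (X : set (cplx a)) (Z : cchain k) : Prop :=
  (forall x, x \in Z -> C1_cube x.2) /\ carrier Z `<=` X.

Definition chain_opp (k : nat) (Z : cchain k) : cchain k :=
  [seq (- x.1, x.2) | x <- Z].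

Definition face (k : nat) (i : 'I_k.+1) (e : bool) (t : 'rV[R]_k) :
    'rV[R]_k.+1 :=
  \row_j (if unlift i j is Some l then t 0 l else e%:R).

Definition boundary (k : nat) (Z : cchain k.+1) : cchain k :=
  [seq ((-1) ^+ (ie.1 + ~~ ie.2) * x.1, x.2 \o face ie.1 ie.2)
    | x : R * ('rV[R]_k.+1 -> cplx a) <- Z,
      ie : 'I_k.+1 * bool <- enum {: 'I_k.+1 * bool}].

Definition degenerate (k : nat) (s : 'rV[R]_k -> cplx a) : Prop :=
  exists i, forall t t', ucube t -> ucube t' ->
    (forall j, j != i -> t 0 j = t' 0 j) -> s t = s t'.

Definition coef (k : nat) (Z : cchain k) (s : 'rV[R]_k -> cplx a) : R :=
  \sum_(x <- Z | `[< forall t, ucube t -> x.2 t = s t >]) x.1.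

(* Cubical chains are taken modulo degenerate cubes. *)
Definition null_chain (k : nat) (Z : cchain k) : Prop :=
  forall s, ~ degenerate s -> coef Z s = 0.

Definition closed_chain (k : nat) : cchain k -> Prop :=
  match k with
  | 0 => fun=> True
  | l.+1 => fun Z => null_chain (boundary Z)
  end.

Definition cycle_in (k : nat) (X : set (cplx a)) (Z : cchain k) : Prop :=
  chain_in X Z /\ closed_chain Z.

Definition homologous (k : nat) (X : set (cplx a)) (Z Z' : cchain k) : Prop :=
  exists2 W : cchain k.+1, chain_in X W &
    null_chain (Z ++ chain_opp Z' ++ chain_opp (boundary W)).

(* The elements of H_k(X, R), as sets of cycles. *)
Definition homology_class (k : nat) (X : set (cplx a)) (h : set (cchain k)) :
    Prop :=
  exists2 Z, cycle_in X Z &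
    h = [set Z' | cycle_in X Z' /\ homologous X Z' Z].

Fixpoint Rcube_int (k : nat) : ('rV[R]_k -> R) -> R :=
  match k with
  | 0 => fun f => f 0
  | l.+1 => fun f =>
      \int[lebesgue_measure]_(x in `[0, 1])
        Rcube_int (fun t : 'rV[R]_l => f (row_mx (x%:M : 'rV[R]_1) t))
  end.

Definition Ccube_int (k : nat) (f : 'rV[R]_k -> R[i]) : R[i] :=
  Rcube_int (fun t => complex.Re (f t)) +i* Rcube_int (fun t => complex.Im (f t)).

(* The coefficient of the pull-back along [s] of the volume form
   d mu = du_1 /\ ... /\ du_r, the u_j being the coordinates in the positive
   Z-basis [g] of the lattice. *)
Definition jacdet (r : nat) (g : r.-tuple a) (s : 'rV[R]_r -> cplx a)
    (t : 'rV[R]_r) : R[i] :=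
  \det (\matrix_(i < r, j < r)
    ('D_(delta_mx 0 i) (fun t' => coord g j (s t').1 : R) t +i*
     'D_(delta_mx 0 i) (fun t' => coord g j (s t').2 : R) t)).

Definition chain_int (r : nat) (g : r.-tuple a) (f : cplx a -> R[i])
    (Z : cchain r) : R[i] :=
  \sum_(x <- Z) x.1%:C * Ccube_int (fun t => f (x.2 t) * jacdet g x.2 t).

(* (2 pi i)^-r times the integral of f d mu over Z. *)
Definition period (r : nat) (g : r.-tuple a) (f : cplx a -> R[i])
    (Z : cchain r) : R[i] :=
  ((2 * pi)%:C * 'i%C) ^- r * chain_int g f Z.

End Chains.

Arguments cchain {R} a k.

Section Arrangement.
Context {R : realType} {a : vectType R} {r n : nat}.
Local Notation dual := 'Hom(a, R^o).
Variables (g : r.-tuple a) (alpha : n.-tuple dual).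

Definition kappa : dual := \sum_i tnth alpha i.

Definition projective : Prop :=
  exists v : a, forall i, 0 < (tnth alpha i v : R).

Definition spanning : Prop :=
  forall k : 'I_n, exists t : 'I_n -> R,
    [/\ forall i, 0 <= t i, t k = 0, forall i, i != k -> t i != 0
      & kappa = \sum_i t i *: tnth alpha i].

Definition Ucompl : set (cplx a) :=
  [set u | forall i, cform (tnth alpha i) u != 0].

(* Index sets sigma with r elements are listed in some order, as r-tuples. *)
Definition subfamily (sigma : r.-tuple 'I_n) : r.-tuple dual :=
  [tuple tnth alpha (tnth sigma k) | k < r].

Definition basis_index (sigma : r.-tuple 'I_n) : Prop :=
  basis_of fullv (subfamily sigma).

Definition cone_boundary (sigma : r.-tuple 'I_n) : set (dual_top g) :=
  closure (ccone (subfamily sigma) : set (dual_top g)) `\`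
  interior (ccone (subfamily sigma) : set (dual_top g)).

Definition regular_set : set (dual_top g) :=
  (ccone alpha : set (dual_top g)) `\`
  \bigcup_(sigma in [set sigma | basis_index sigma]) cone_boundary sigma.

Definition chamber (c : set (dual_top g)) : Prop :=
  exists2 xi, regular_set xi & c = connected_component regular_set xi.

Definition polar (c : set (dual_top g)) : set a :=
  [set v | forall xi : dual, c xi -> 0 <= (xi v : R)].

Definition positive_basis (c : set (dual_top g)) (lam : r.-tuple a) : Prop :=
  [/\ zspan lam = lattice g, polar c `<=` ccone lam
    & forall j, 0 <= (kappa (tnth lam j) : R)].

(* Polynomial over a product of powers of the alpha_i. *)
Definition fraction (Q : {mpoly R[i][r]}) (m : 'I_n -> nat) (u : cplx a) :
    R[i] :=
  meval (fun j => ccoord g j u) Q / \prod_i cform (tnth alpha i) u ^+ m i.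

(* Elements of C_A[a]; they are identified when they agree on U(A). *)
Definition ratA (f : cplx a -> R[i]) : Prop :=
  exists Q m, forall u, Ucompl u -> f u = fraction Q m u.

Definition homogeneous (d : int) (f : cplx a -> R[i]) : Prop :=
  forall (t : R[i]) u, t != 0 -> Ucompl u -> f (cplx_scale t u) = t ^ d * f u.

Definition vol (sigma : r.-tuple 'I_n) : R :=
  \det (\matrix_(i < r, j < r) (tnth (subfamily sigma) i (tnth g j) : R)).

Definition is_JK (c : set (dual_top g)) (J : (cplx a -> R[i]) -> R[i]) : Prop :=
  [/\ (forall f1 f2, ratA f1 -> (forall u, Ucompl u -> f1 u = f2 u) -> J f1 = J f2) /\
      (forall (t : R[i]) f1 f2, ratA f1 -> ratA f2 ->
         J (fun u => t * f1 u + f2 u) = t * J f1 + J f2),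
      forall sigma, basis_index sigma ->
        J (fun u => (\prod_k cform (tnth (subfamily sigma) k) u)^-1) =
        (if `[< c `<=` ccone (subfamily sigma) >]
         then `|vol sigma|^-1%:C else 0),
      forall (d : int) f, ratA f -> homogeneous d f -> d != - r%:Z -> J f = 0
    & forall Q (m : 'I_n -> nat),
        span [seq tnth alpha i | i <- enum 'I_n & m i != 0%N] != fullv ->
        J (fraction Q m) = 0].

(* h(c) is the class whose periods give JK_c. *)
Definition is_hclass (c : set (dual_top g)) (h : set (cchain a r)) : Prop :=
  homology_class Ucompl h /\
  exists2 J, is_JK c J &
    forall Z f, h Z -> ratA f -> J f = period g f Z.

Definition hclass (c : set (dual_top g)) : set (cchain a r) :=
  xget set0 [set h | is_hclass c h].

Definition kappa_disc : set (cplx a) := [set u | `|cform kappa u| < 1].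

(* The pairings <alpha_i, lam> are integers when [lam] is in the lattice. *)
Definition pfun (lam : a) (u : cplx a) : R[i] :=
  \prod_i cform (tnth alpha i) u ^ Num.floor (tnth alpha i lam : R).

Definition zmon (z : 'I_n -> R[i]) (lam : a) : R[i] :=
  \prod_i z i ^ Num.floor (tnth alpha i lam : R).

Definition evalP (P : {mpoly R[i][n]}) (u : cplx a) : R[i] :=
  meval (fun i => cform (tnth alpha i) u) P.

Definition admissible_cycle (c : set (dual_top g)) (Z : cchain a r) : Prop :=
  hclass c Z /\ carrier Z `<=` Ucompl `&` kappa_disc.

(* The value does not depend on the choice of the admissible cycle. *)
Definition bracket (c : set (dual_top g)) (P : {mpoly R[i][n]}) (lam : a) :
    R[i] :=
  period g
    (fun u => evalP P u / ((1 - cform kappa u) * pfun lam u *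
                           \prod_i cform (tnth alpha i) u))
    (xget [::] [set Z | admissible_cycle c Z]).

End Arrangement.

(* Main.v *)
Require Import Defs.
From HB Require Import structures.
From mathcomp Require Import all_boot all_order all_algebra.
From mathcomp Require Import finmap complex.
From mathcomp Require Import mpoly.
From mathcomp Require Import all_classical all_reals all_analysis.
From mathcomp Require Import ring.

Import Order.TTheory GRing.Theory Num.Theory.
Import numFieldNormedType.Exports.

Local Open Scope classical_set_scope.
Local Open Scope complex_scope.
Local Open Scope ring_scope.

(** Write p_j, q_j for p_(lambda_j), z^(lambda_j), and w_j = q_j / p_j.  On the
    cycle Z the factors p_j / (p_j - q_j) = 1 / (1 - w_j) of the integrand are
    sums of geometric series in w_j.  The carrier of Z is compact, so the
    inequalities |w_j| < 1 hold with a uniform ratio rho < 1 and the r-fold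
    geometric series may be integrated term by term.  The exponents in N^r
    enumerate the lattice points l of the cone spanned by the lambda_j, and the
    term with exponent l integrates to z^l times the integral b_l of
    P / ((1 - kappa) p_l prod alpha_i) over Z.  It remains to see that b_l is
    the bracket of l and that it vanishes unless l lies in the polar cone of c;
    the lattice points of that cone all lie in the cone spanned by the lambda_j.

    Both facts come from expanding 1 / (1 - kappa) as well: since |kappa| < 1 on
    the compact carrier, b_l is the limit of the partial sums of
    JK_c (P kappa^k / (p_l prod alpha_i)), and these numbers do not mention
    the cycle (period_bracket_approx, period_bracket_unique).  Moreover the
    poles of P kappa^k / (p_l prod alpha_i) are along those alpha_i with
    <alpha_i, l> >= 0.  If JK_c did not vanish on such a fraction, the cone of
    some basis chosen among these alpha_i would contain c (JK_vanish), and then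
    l would be nonnegative on c, that is, in the polar cone.

    JK_vanish is an induction on the order m of the denominator.  When the forms
    of the denominator do not span the dual space the value is 0 by definition
    of JK_c.  When they do, every coordinate is a combination of them, so every
    nonconstant monomial of the numerator cancels against the denominator.
    This leaves 1 / prod alpha_i^(m_i), on which JK_c vanishes by homogeneity
    unless m has total degree r; in that case the forms make up a basis.

    Term by term integration uses that the integral over a chain is linear and
    bounded by a multiple of the supremum of the integrand, for integrands that
    are continuous on the carrier (period_lin, period_bound).  As the integral
    over a cube is an iterated Lebesgue integral, this needs the continuity of
    the inner integral in the outer variable (slice_continuous).  The
    convergence of the unordered sum is measured by box_sum_approx, which
    compares the full product of geometric series with its partial sums over
    any finite set of exponents that contains a large box. *)

(** * Integration of continuous functions over the unit cube *)

Section CubeIntegral.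
Set Implicit Arguments.
Unset Strict Implicit.
Context {R : realType}.

Lemma continuous_ext (T U : topologicalType) (f g : T -> U) :
  f =1 g -> continuous g -> continuous f.
Proof. by move=> /funext ->. Qed.

Lemma contD (T : topologicalType) (f g : T -> R) :
  continuous f -> continuous g -> continuous (fun x => f x + g x).
Proof. by move=> cf cg x; exact: (continuousD (cf x) (cg x)). Qed.

Lemma contM (T : topologicalType) (f g : T -> R) :
  continuous f -> continuous g -> continuous (fun x => f x * g x).
Proof. by move=> cf cg x; exact: (continuousM (cf x) (cg x)). Qed.

Lemma contN (T : topologicalType) (f : T -> R) :
  continuous f -> continuous (fun x => - f x).
Proof. by move=> cf x; exact: (continuousN (cf x)). Qed.

Lemma contV (T : topologicalType) (f : T -> R) :
  (forall x, f x != 0) -> continuous f -> continuous (fun x => (f x)^-1).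
Proof. by move=> f0 cf x; exact: (continuousV (f0 x) (cf x)). Qed.

Lemma mx_continuous (T : topologicalType) m n (f : T -> 'M[R]_(m, n)) :
  (forall i j, continuous (fun x => f x i j)) -> continuous f.
Proof.
move=> cf x A [P nP PA].
apply: (@filterS _ _ _ [set y | forall i j, P i j (f y i j)]).
  by move=> y Py; apply: PA.
apply: filter_forall => i; apply: filter_forall => j.
exact: (cf i j x _ (nP i j)).
Qed.

Lemma ucube_compact k : compact (@ucube R k).
Proof.
have := @rV_compact R k (fun=> `[0 : R, 1]%classic) (fun=> @segment_compact R 0 1).
by congr compact; apply/seteqP; split => t /= ht j; have := ht j; rewrite /= in_itv.
Qed.

Lemma ucube_neq0 k : @ucube R k !=set0.
Proof. by exists 0 => j; rewrite mxE lexx ler01. Qed.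

(** The nearest point of the cube.  Composing with it turns a function that is
    continuous on the cube into one that is continuous everywhere, which avoids
    subspace topologies. *)
Definition clamp k (t : 'rV[R]_k) : 'rV[R]_k :=
  \row_j Num.min 1 (Num.max 0 (t 0 j)).

Lemma clamp_ucube k (t : 'rV[R]_k) : ucube (clamp t).
Proof.
move=> j; rewrite mxE ge_min lexx andbT le_min ler01 le_max lexx.
by [].
Qed.

Lemma clamp_id k (t : 'rV[R]_k) : ucube t -> clamp t = t.
Proof.
move=> tc; apply/rowP => j; rewrite mxE.
by have /andP[t0 t1] := tc j; rewrite max_r// min_r.
Qed.

Lemma clamp_continuous k : continuous (@clamp k).
Proof.
apply: mx_continuous => i j; rewrite ord1.
apply: (@continuous_ext _ _ _ (fun t : 'rV[R]_k => Num.min 1 (Num.max 0 (t 0 j)))).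
  by move=> t; rewrite mxE.
move=> t; apply: (@continuous_min R 'rV[R]_k (fun=> 1) (fun t => Num.max 0 (t 0 j))).
  exact: cst_continuous.
apply: (@continuous_max R 'rV[R]_k (fun=> 0) (fun t => t 0 j)).
  exact: cst_continuous.
exact: coord_continuous.
Qed.

Lemma Rcube_int_ext k (f g : 'rV[R]_k -> R) :
  (forall t, ucube t -> f t = g t) -> Rcube_int f = Rcube_int g.
Proof.
elim: k f g => [|k IH] f g fg /=; first by apply: fg => -[].
apply: eq_Rintegral => x; rewrite inE /= in_itv /= => x01.
apply: IH => t tc; apply: fg => j; rewrite mxE.
by case: splitP => l _ //; rewrite !mxE ord1 eqxx.
Qed.

(** Linearity and the bound by the supremum are proved together, by induction on
    the dimension: the step needs that the inner integral is continuous in the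
    outer variable, and this already uses both properties of the inner integral. *)
Definition Rcube_int_lin_bound k : Prop := forall (f g : 'rV[R]_k -> R) (b M : R),
  continuous f -> continuous g ->
  Rcube_int (fun t => b * f t + g t) = b * Rcube_int f + Rcube_int g /\
  ((forall t, ucube t -> `|f t| <= M) -> `|Rcube_int f| <= M).

Lemma row_mx_continuous2 k : continuous
  (fun p : 'rV[R]_k * R => row_mx (p.2%:M : 'rV[R]_1) p.1 : 'rV[R]_k.+1).
Proof.
apply: (@mx_continuous _ 1 (k.+1)) => i j; rewrite {i}ord1.
case: (splitP (j : 'I_(1 + k))) => l jl.
  apply: (@continuous_ext _ _ _ snd); last by move=> p; exact: cvg_snd.
  move=> p; have -> : j = lshift k l by exact: val_inj.
  by rewrite (row_mxEl (p.2%:M : 'rV[R]_1)) mxE (ord1 l) eqxx mulr1n.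
apply: (@continuous_ext _ _ _ (fun p : 'rV[R]_k * R => p.1 0 l)).
  move=> p; have -> : j = rshift 1 l by exact: val_inj.
  by rewrite (row_mxEr (p.2%:M : 'rV[R]_1)).
move=> p.
apply: (@continuous_comp _ _ _ fst (fun t : 'rV[R]_k => t 0 l)).
  exact: cvg_fst.
exact: coord_continuous.
Qed.

Lemma row_mx_continuous k (x : R) :
  continuous (fun t : 'rV[R]_k => row_mx (x%:M : 'rV[R]_1) t : 'rV[R]_k.+1).
Proof.
apply: (@mx_continuous _ 1 (k.+1)) => i j; rewrite {i}ord1.
case: (splitP (j : 'I_(1 + k))) => l jl.
  apply: (@continuous_ext _ _ _ (fun=> x)); last by move=> p; exact: cst_continuous.
  move=> t; have -> : j = lshift k l by exact: val_inj.
  by rewrite (row_mxEl (x%:M : 'rV[R]_1)) mxE (ord1 l) eqxx mulr1n.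
apply: (@continuous_ext _ _ _ (fun t : 'rV[R]_k => t 0 l)).
  move=> t; have -> : j = rshift 1 l by exact: val_inj.
  by rewrite (row_mxEr (x%:M : 'rV[R]_1)).
exact: coord_continuous.
Qed.

Definition slice k (F : 'rV[R]_k.+1 -> R) (x : R) (t : 'rV[R]_k) : R :=
  F (row_mx (x%:M : 'rV[R]_1) t).

Lemma continuous_slice k (F : 'rV[R]_k.+1 -> R) x :
  continuous F -> continuous (slice F x).
Proof.
move=> cF t; apply: (@continuous_comp _ _ _
  (fun t : 'rV[R]_k => row_mx (x%:M : 'rV[R]_1) t : 'rV[R]_k.+1) F).
  exact: row_mx_continuous.
exact: cF.
Qed.

(** Continuity of a parametric integral over a compact set: by compactness of
    the cube, F (x, t) is uniformly close to F (x0, t) for all t in the cube as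
    soon as x is close to x0. *)
Lemma slice_continuous k (F : 'rV[R]_k.+1 -> R) :
  Rcube_int_lin_bound k -> continuous F ->
  continuous (fun x => Rcube_int (slice F x)).
Proof.
move=> lb cF x0; apply/cvgrPdist_le => eps eps0.
have cFx x : continuous (slice F x) by exact: continuous_slice.
have cov := (compact_near_coveringP _).1 (@ucube_compact k).
have := @cov R (nbhs x0) (fun x t => `|slice F x0 t - slice F x t| <= eps)
  (nbhs_filter x0).
have close t : ucube t -> \forall t' \near t & x \near x0,
    `|slice F x0 t' - slice F x t'| <= eps.
  move=> _.
  pose h (p : 'rV[R]_k * R) : R := slice F x0 p.1 - slice F p.2 p.1.
  have ch : {for (t, x0), continuous h}.
    apply: cvgB.
      apply: (@continuous_comp _ _ _ fst (slice F x0)).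
        exact: cvg_fst.
      exact: cFx.
    apply: (@continuous_comp _ _ _ (fun p : 'rV[R]_k * R =>
      row_mx (p.2%:M : 'rV[R]_1) p.1 : 'rV[R]_k.+1) F).
      exact: row_mx_continuous2.
    exact: cF.
  move/cvgrPdist_le : ch => /(_ _ eps0).
  case=> -[A B] /= [nA nB] AB; exists (A, B) => // -[t' x] /= ABt'x.
  by have := AB (t', x) ABt'x; rewrite /h /= subrr sub0r normrN.
move=> /(_ close); apply: filterS => x hx /=.
have [lin _] := lb _ _ (-1) 0 (cFx x) (cFx x0).
rewrite addrC -mulN1r -lin.
have cdiff : continuous (fun t => -1 * slice F x t + slice F x0 t).
  by apply: contD => //; apply: contM => //; exact: cst_continuous.
have [_] := lb _ _ 0 eps cdiff (cFx x0).
apply => t tc; rewrite mulN1r addrC; exact: hx.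
Qed.

Lemma continuous_itv01_integrable (f : R -> R) : continuous f ->
  (@lebesgue_measure R).-integrable `[0, 1] (EFin \o f).
Proof.
move=> cf; apply: continuous_compact_integrable; first exact: segment_compact.
exact: continuous_subspaceT.
Qed.

Lemma Rcube_int_lin_boundP k : Rcube_int_lin_bound k.
Proof.
elim: k => [|k IH] f g b M cf cg.
  by split=> //= fM; apply: fM; case.
have If := continuous_itv01_integrable (slice_continuous IH cf).
have Ig := continuous_itv01_integrable (slice_continuous IH cg).
split=> [|fM] /=.
  rewrite -RintegralZl// -RintegralD//; last first.
    apply: continuous_itv01_integrable; apply: contM; first exact: cst_continuous.
    exact: slice_continuous.
  apply: eq_Rintegral => x _.
  exact: (IH _ _ b 0 (continuous_slice (x := x) cf) (continuous_slice (x := x) cg)).1.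
apply: (le_trans (le_normr_Rintegral _ If)) => //.
have M1 : \int[@lebesgue_measure R]_(x in `[0, 1]) M = M.
  have E := @lebesgue_measure_itv R `[0, 1].
  rewrite /= lte_fin ltr01 oppr0 adde0 in E.
  by rewrite Rintegral_cst// [X in fine X](_ : _ = 1%:E) ?mulr1 //; exact: E.
rewrite -[leRHS]M1; apply: le_Rintegral => //.
- have := integrable_norm If; apply: eq_integrable => //.
- by apply: continuous_itv01_integrable => x; exact: cst_continuous.
move=> x /=; rewrite in_itv /= => x01.
apply: (IH _ _ 0 M (continuous_slice (x := x) cf) (continuous_slice (x := x) cf)).2 => t tc.
apply: fM => j; rewrite mxE.
by case: splitP => l _ //; rewrite !mxE ord1 eqxx.
Qed.
End CubeIntegral.

(** * Complex functions that are continuous on the unit cube *)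

Section CubeContinuity.
Set Implicit Arguments.
Unset Strict Implicit.
Context {R : realType}.

Definition cube_cont k (f : 'rV[R]_k -> R[i]) : Prop :=
  continuous (fun t => complex.Re (f (clamp t))) /\
  continuous (fun t => complex.Im (f (clamp t))).

Lemma cube_cont_ext k (f g : 'rV[R]_k -> R[i]) :
  (forall t, ucube t -> f t = g t) -> cube_cont g -> cube_cont f.
Proof.
move=> fg [g1 g2].
by split; [move: g1|move: g2]; apply: continuous_ext => t; rewrite fg//;
  exact: clamp_ucube.
Qed.

Lemma cube_contC k (b : R[i]) : cube_cont (fun _ : 'rV[R]_k => b).
Proof. by split; exact: cst_continuous. Qed.

Lemma cube_contD k (f g : 'rV[R]_k -> R[i]) :
  cube_cont f -> cube_cont g -> cube_cont (fun t => f t + g t).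
Proof.
move=> [f1 f2] [g1 g2]; split.
  by apply: continuous_ext (contD f1 g1) => t; case: (f _) (g _) => ? ? [].
by apply: continuous_ext (contD f2 g2) => t; case: (f _) (g _) => ? ? [].
Qed.

Lemma cube_contM k (f g : 'rV[R]_k -> R[i]) :
  cube_cont f -> cube_cont g -> cube_cont (fun t => f t * g t).
Proof.
move=> [f1 f2] [g1 g2]; split.
  apply: continuous_ext (contD (contM f1 g1) (contN (contM f2 g2))) => t.
  by case: (f _) (g _) => ? ? [].
apply: continuous_ext (contD (contM f1 g2) (contM f2 g1)) => t.
by case: (f _) (g _) => ? ? [].
Qed.

Lemma cube_contN k (f : 'rV[R]_k -> R[i]) :
  cube_cont f -> cube_cont (fun t => - f t).
Proof.
move=> [f1 f2]; split.
  by apply: continuous_ext (contN f1) => t; case: (f _).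
by apply: continuous_ext (contN f2) => t; case: (f _).
Qed.

Lemma cube_contV k (f : 'rV[R]_k -> R[i]) :
  (forall t, ucube t -> f t != 0) -> cube_cont f ->
  cube_cont (fun t => (f t)^-1).
Proof.
move=> f0 [f1 f2].
have n0 t : complex.Re (f (clamp t)) * complex.Re (f (clamp t)) +
            complex.Im (f (clamp t)) * complex.Im (f (clamp t)) != 0.
  have := f0 _ (clamp_ucube t); apply: contra.
  rewrite -!expr2 paddr_eq0 ?sqr_ge0// !sqrf_eq0 eq_complex.
  by [].
(* 1 / (x + i y) = (x - i y) / (x ^ 2 + y ^ 2) *)
have nV := contV n0 (contD (contM f1 f1) (contM f2 f2)).
split.
  apply: continuous_ext (contM f1 nV) => t.
  by case: (f (clamp t)) => x y /=; rewrite !expr2.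
apply: continuous_ext (contM (contN f2) nV) => t.
by case: (f (clamp t)) => x y /=; rewrite !expr2 mulNr.
Qed.

Lemma cube_cont_sum k (I : Type) (s : seq I) (P : pred I)
    (f : I -> 'rV[R]_k -> R[i]) :
  (forall i, cube_cont (f i)) -> cube_cont (fun t => \sum_(i <- s | P i) f i t).
Proof.
move=> cf; elim: s => [|i s IH].
  by apply: cube_cont_ext (cube_contC _ 0) => t _; rewrite big_nil.
have [Pi|Pi] := boolP (P i).
  by apply: cube_cont_ext (cube_contD (cf i) IH) => t _; rewrite big_cons Pi.
by apply: cube_cont_ext IH => t _; rewrite big_cons (negbTE Pi).
Qed.

Lemma cube_cont_prod k (I : Type) (s : seq I) (P : pred I)
    (f : I -> 'rV[R]_k -> R[i]) :
  (forall i, cube_cont (f i)) -> cube_cont (fun t => \prod_(i <- s | P i) f i t).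
Proof.
move=> cf; elim: s => [|i s IH].
  by apply: cube_cont_ext (cube_contC _ 1) => t _; rewrite big_nil.
have [Pi|Pi] := boolP (P i).
  by apply: cube_cont_ext (cube_contM (cf i) IH) => t _; rewrite big_cons Pi.
by apply: cube_cont_ext IH => t _; rewrite big_cons (negbTE Pi).
Qed.

Lemma cube_contX k (f : 'rV[R]_k -> R[i]) m :
  cube_cont f -> cube_cont (fun t => f t ^+ m).
Proof.
move=> cf; elim: m => [|m IH].
  by apply: cube_cont_ext (cube_contC _ 1) => t _; rewrite expr0.
by apply: cube_cont_ext (cube_contM cf IH) => t _; rewrite exprS.
Qed.

Lemma cube_contXz k (f : 'rV[R]_k -> R[i]) (m : int) :
  (forall t, ucube t -> f t != 0) ->
  cube_cont f -> cube_cont (fun t => f t ^ m).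
Proof.
move=> f0 cf; case: m => m; first exact: cube_contX.
apply: (@cube_contV _ (fun t => f t ^+ m.+1)); last exact: cube_contX.
by move=> t tc; rewrite expf_neq0// f0.
Qed.

(** The cube is compact and nonempty. *)
Lemma cube_cont_max k (f : 'rV[R]_k -> R[i]) : cube_cont f ->
  exists2 t0, ucube t0 & forall t, ucube t -> `|f t| <= `|f t0|.
Proof.
move=> [f1 f2].
pose re t := complex.Re (f (clamp t)); pose im t := complex.Im (f (clamp t)).
pose h (t : 'rV[R]_k) : R := Num.sqrt (re t * re t + im t * im t).
have ch : continuous h.
  move=> t; apply: (@continuous_comp _ _ _
    (fun t => re t * re t + im t * im t) Num.sqrt).
    exact: (contD (contM f1 f1) (contM f2 f2)).
  exact: sqrt_continuous.
have [t0 t0c mx] := compact_EVT_max (@ucube_neq0 R k) (@ucube_compact R k)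
   (continuous_subspaceT ch).
rewrite inE in t0c; exists t0 => // t tc.
have := mx t; rewrite inE => /(_ tc).
by rewrite /h /re /im !clamp_id// !normc_def -!expr2 lecR.
Qed.

Lemma Rcube_lin k (f g : 'rV[R]_k -> R) b :
  continuous (fun t => f (clamp t)) -> continuous (fun t => g (clamp t)) ->
  Rcube_int (fun t => b * f t + g t) = b * Rcube_int f + Rcube_int g.
Proof.
move=> cf cg.
have E (h : 'rV[R]_k -> R) : Rcube_int h = Rcube_int (fun t => h (clamp t)).
  by apply: Rcube_int_ext => t tc; rewrite clamp_id.
rewrite E (E f) (E g).
exact: (Rcube_int_lin_boundP b 0 cf cg).1.
Qed.

Lemma Rcube_bound k (f : 'rV[R]_k -> R) M :
  continuous (fun t => f (clamp t)) ->
  (forall t, ucube t -> `|f t| <= M) -> `|Rcube_int f| <= M.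
Proof.
move=> cf fM.
have -> : Rcube_int f = Rcube_int (fun t => f (clamp t)).
  by apply: Rcube_int_ext => t tc; rewrite clamp_id.
apply: (Rcube_int_lin_boundP 0 M cf cf).2 => t tc; rewrite clamp_id//; exact: fM.
Qed.

Lemma Ccube_ext k (f g : 'rV[R]_k -> R[i]) :
  (forall t, ucube t -> f t = g t) -> Ccube_int f = Ccube_int g.
Proof.
move=> fg; rewrite /Ccube_int; congr (_ +i* _);
  by apply: Rcube_int_ext => t tc; rewrite fg.
Qed.

Lemma Ccube_lin k (f g : 'rV[R]_k -> R[i]) b :
  cube_cont f -> cube_cont g ->
  Ccube_int (fun t => b * f t + g t) = b * Ccube_int f + Ccube_int g.
Proof.
case: b => b1 b2 [f1 f2] [g1 g2].
have cst (x : R) : continuous (fun _ : 'rV[R]_k => x) by exact: cst_continuous.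
have c1 := contD (contM (cst (- b2)) f2) g1.
have c2 := contD (contM (cst b2) f1) g2.
have e1 : Rcube_int (fun t => complex.Re ((b1 +i* b2) * f t + g t)) =
  Rcube_int (fun t => b1 * complex.Re (f t) +
     (- b2 * complex.Im (f t) + complex.Re (g t))).
  by apply: Rcube_int_ext => t _; case: (f t) (g t) => ? ? [? ?] /=;
    rewrite mulNr addrA.
have e2 : Rcube_int (fun t => complex.Im ((b1 +i* b2) * f t + g t)) =
  Rcube_int (fun t => b1 * complex.Im (f t) +
     (b2 * complex.Re (f t) + complex.Im (g t))).
  by apply: Rcube_int_ext => t _; case: (f t) (g t) => ? ? [? ?] /=;
    rewrite addrA.
rewrite /Ccube_int e1 e2 !Rcube_lin//=.
by apply/eqP; rewrite eq_complex /= mulNr !addrA !eqxx.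
Qed.

Lemma Ccube_bound k (f : 'rV[R]_k -> R[i]) (M : R) : cube_cont f ->
  (forall t, ucube t -> `|f t| <= M%:C) -> `|Ccube_int f| <= (2 * M)%:C.
Proof.
move=> [f1 f2] fM; rewrite /Ccube_int [X in `|X|]complexE /=.
have b1 := @Rcube_bound k (fun t => complex.Re (f t)) M f1.
have b2 := @Rcube_bound k (fun t => complex.Im (f t)) M f2.
apply: (le_trans (ler_normD _ _)).
rewrite normrM.
have -> : `|'i%C| = 1 :> R[i] by rewrite normc_def /= expr0n expr1n add0r sqrtr1.
rewrite mul1r mulr_natl mulr2n rmorphD /= !normc_def /= !expr0n /= !addr0 !sqrtr_sqr.
apply: lerD; rewrite lecR.
  apply: b1 => t tc; have := fM t tc; rewrite normc_def lecR; apply: le_trans.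
  by rewrite -sqrtr_sqr ler_wsqrtr// lerDl sqr_ge0.
apply: b2 => t tc; have := fM t tc; rewrite normc_def lecR; apply: le_trans.
by rewrite -sqrtr_sqr ler_wsqrtr// lerDr sqr_ge0.
Qed.
End CubeContinuity.

(** * Integrals over chains *)

Section ChainIntegral.
Set Implicit Arguments.
Unset Strict Implicit.
Context {R : realType} {a : vectType R}.
Implicit Types (f : cplx a -> R[i]).

Definition chain_cont k (Z : cchain a k) f : Prop :=
  forall x, x \in Z -> cube_cont (f \o x.2).

(** The determinant is a polynomial in the first derivatives of a C^1 cube. *)
Lemma cube_cont_jacdet r (g : r.-tuple a) (s : 'rV[R]_r -> cplx a) :
  C1_cube s -> cube_cont (jacdet g s).
Proof.
move=> Cs; apply: cube_cont_sum => p; apply: cube_contM; first exact: cube_contC.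
apply: cube_cont_prod => i.
pose j := perm.fun_of_perm p i.
pose xi : 'Hom(a, R^o) := linfun (coord g j : a -> R^o).
have [[_ C1] [_ C2]] := Cs xi.
have E v : coord g j v = xi v by rewrite lfunE.
apply: (@cube_cont_ext _ _ _ (fun t =>
    'D_(delta_mx 0 i) (fun t' => xi (s t').1 : R) t +i*
    'D_(delta_mx 0 i) (fun t' => xi (s t').2 : R) t)).
  move=> t _; rewrite mxE; congr (_ +i* _); congr ('D_ _ _ t);
    by apply/funext => t'; rewrite -E.
have cc h : continuous h -> continuous (fun t => h (@clamp R r t) : R).
  move=> ch t; apply: (@continuous_comp _ _ _ (@clamp R r) h).
    exact: clamp_continuous.
  exact: ch.
split; [exact: (cc _ (C1 (delta_mx 0 i)))|exact: (cc _ (C2 (delta_mx 0 i)))].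
Qed.

Lemma chain_contC k (Z : cchain a k) b : chain_cont Z (fun=> b).
Proof. by move=> x _; exact: cube_contC. Qed.

Lemma chain_contD k (Z : cchain a k) f1 f2 :
  chain_cont Z f1 -> chain_cont Z f2 -> chain_cont Z (fun u => f1 u + f2 u).
Proof. by move=> c1 c2 x xZ; exact: cube_contD (c1 x xZ) (c2 x xZ). Qed.

Lemma chain_contM k (Z : cchain a k) f1 f2 :
  chain_cont Z f1 -> chain_cont Z f2 -> chain_cont Z (fun u => f1 u * f2 u).
Proof. by move=> c1 c2 x xZ; exact: cube_contM (c1 x xZ) (c2 x xZ). Qed.

Lemma chain_contN k (Z : cchain a k) f :
  chain_cont Z f -> chain_cont Z (fun u => - f u).
Proof. by move=> c x xZ; exact: cube_contN (c x xZ). Qed.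

Lemma chain_contB k (Z : cchain a k) f1 f2 :
  chain_cont Z f1 -> chain_cont Z f2 -> chain_cont Z (fun u => f1 u - f2 u).
Proof. by move=> c1 c2; exact: chain_contD c1 (chain_contN c2). Qed.

Lemma carrierP k (Z : cchain a k) x t : x \in Z -> ucube t -> carrier Z (x.2 t).
Proof. by move=> xZ tc; exists x => //; exists t. Qed.

Lemma chain_contV k (Z : cchain a k) f :
  (forall u, carrier Z u -> f u != 0) ->
  chain_cont Z f -> chain_cont Z (fun u => (f u)^-1).
Proof.
move=> f0 c x xZ; apply: (@cube_contV _ _ (f \o x.2)); last exact: c.
by move=> t tc; apply: f0; exact: carrierP.
Qed.

Lemma chain_contX k (Z : cchain a k) f m :
  chain_cont Z f -> chain_cont Z (fun u => f u ^+ m).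
Proof. by move=> c x xZ; exact: cube_contX (c x xZ). Qed.

Lemma chain_contXz k (Z : cchain a k) f (m : int) :
  (forall u, carrier Z u -> f u != 0) ->
  chain_cont Z f -> chain_cont Z (fun u => f u ^ m).
Proof.
move=> f0 c x xZ; apply: (@cube_contXz _ _ (f \o x.2)); last exact: c.
by move=> t tc; apply: f0; exact: carrierP.
Qed.

Lemma chain_cont_sum k (Z : cchain a k) (I : Type) (s : seq I) (P : pred I)
    (f : I -> cplx a -> R[i]) :
  (forall i, chain_cont Z (f i)) ->
  chain_cont Z (fun u => \sum_(i <- s | P i) f i u).
Proof.
move=> c x xZ; apply: (@cube_cont_sum _ _ _ s P (fun i => f i \o x.2)) => i.
exact: c.
Qed.

Lemma chain_cont_prod k (Z : cchain a k) (I : Type) (s : seq I) (P : pred I)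
    (f : I -> cplx a -> R[i]) :
  (forall i, chain_cont Z (f i)) ->
  chain_cont Z (fun u => \prod_(i <- s | P i) f i u).
Proof.
move=> c x xZ; apply: (@cube_cont_prod _ _ _ s P (fun i => f i \o x.2)) => i.
exact: c.
Qed.

Lemma chain_cont_ext k (Z : cchain a k) f1 f2 :
  (forall u, carrier Z u -> f1 u = f2 u) -> chain_cont Z f2 -> chain_cont Z f1.
Proof.
move=> e c x xZ; apply: cube_cont_ext (c x xZ) => t tc /=; apply: e.
exact: carrierP.
Qed.

Lemma chain_cont_cform k (Z : cchain a k) (xi : 'Hom(a, R^o)) :
  (forall x, x \in Z -> C1_cube x.2) -> chain_cont Z (cform xi).
Proof.
move=> C x xZ; have [[d1 _] [d2 _]] := C x xZ xi.
have cc h : continuous h -> continuous (fun t => h (@clamp R k t) : R).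
  move=> ch t; apply: (@continuous_comp _ _ _ (@clamp R k) h).
    exact: clamp_continuous.
  exact: ch.
by split; [apply: (cc (fun t => xi (x.2 t).1)) | apply: (cc (fun t => xi (x.2 t).2))];
  move=> t; exact: differentiable_continuous.
Qed.

(** The bound is a maximum of the modulus on the carrier; so any strict bound of
    the modulus is a strict bound of M, which is how a ratio below 1 is obtained
    for the geometric series.  For an empty chain M is 0, whence the condition
    on b. *)
Lemma chain_cont_bound k (Z : cchain a k) f : chain_cont Z f ->
  exists2 M : R, 0 <= M & (forall u, carrier Z u -> `|f u| <= M%:C) /\
    forall b : R, 0 < b -> (forall u, carrier Z u -> `|f u| < b%:C) -> M < b.
Proof.
elim: Z => [|x Z IH] c.
  by exists 0 => //; split=> [u|b b0 _] //; case=> y; rewrite inE.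
have [|M M0 [M1 M2]] := IH.
  by move=> y yZ; apply: c; rewrite inE yZ orbT.
have xZ : x \in x :: Z by rewrite inE eqxx.
have [t0 t0c t0M] := cube_cont_max (c x xZ).
pose N := Num.sqrt (complex.Re (f (x.2 t0)) ^+ 2 + complex.Im (f (x.2 t0)) ^+ 2).
have NE : `|f (x.2 t0)| = N%:C by rewrite normc_def.
exists (Num.max M N); first by rewrite le_max M0.
split=> [u [y yZ [t tc ->]]|b b0 fb].
  move: yZ; rewrite inE => /orP[/eqP ->|yZ].
    by apply: le_trans (t0M t tc) _; rewrite /= NE lecR le_max lexx orbT.
  apply: (@le_trans _ _ (M%:C)); first by apply: M1; exact: carrierP.
  by rewrite lecR le_max lexx.
rewrite gt_max M2//=; last first.
  by move=> u [y yZ [t tc ->]]; apply: fb; apply: carrierP => //; rewrite inE yZ orbT.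
by rewrite -ltcR -NE; apply: fb; exact: carrierP.
Qed.

Section Period.
Context {r : nat} (g : r.-tuple a) (Z : cchain a r).
Hypothesis C1Z : forall x, x \in Z -> C1_cube x.2.

Lemma period_ext f1 f2 :
  (forall u, carrier Z u -> f1 u = f2 u) -> period g f1 Z = period g f2 Z.
Proof.
move=> e; congr (_ * _); apply: eq_big_seq => x xZ; congr (_ * _).
by apply: Ccube_ext => t tc; rewrite e//; exact: carrierP.
Qed.

Lemma period_lin f1 f2 b : chain_cont Z f1 -> chain_cont Z f2 ->
  period g (fun u => b * f1 u + f2 u) Z = b * period g f1 Z + period g f2 Z.
Proof.
move=> c1 c2; rewrite /period mulrCA -mulrDr; congr (_ * _).
rewrite /chain_int big_distrr -big_split /=; apply: eq_big_seq => x xZ.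
rewrite mulrCA -mulrDr; congr (_ * _).
have cj := cube_cont_jacdet g (C1Z xZ).
rewrite -Ccube_lin; [|exact: cube_contM (c1 x xZ) cj|exact: cube_contM (c2 x xZ) cj].
by apply: Ccube_ext => t _; rewrite mulrDl mulrA.
Qed.

Lemma period_sum (I : Type) (s : seq I) (Q : pred I) (b : I -> R[i])
    (f : I -> cplx a -> R[i]) : (forall i, chain_cont Z (f i)) ->
  period g (fun u => \sum_(i <- s | Q i) b i * f i u) Z =
  \sum_(i <- s | Q i) b i * period g (f i) Z.
Proof.
move=> cf; have cs s' : chain_cont Z (fun u => \sum_(i <- s' | Q i) b i * f i u).
  apply: (@chain_cont_sum _ _ _ _ _ (fun i u => b i * f i u)) => i.
  by apply: chain_contM => //; exact: chain_contC.
elim: s => [|i s IH].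
  have c0 := @chain_contC r Z 0.
  have := @period_lin (fun=> 0) (fun=> 0) (-1) c0 c0.
  rewrite [X in _ = X + _]mulN1r [RHS]addNr big_nil => E; rewrite -[RHS]E.
  by apply: period_ext => u _; rewrite big_nil mulr0 addr0.
have [Qi|/negbTE Qi] := boolP (Q i); rewrite big_cons Qi.
  rewrite -IH -period_lin//.
  by apply: period_ext => u _; rewrite big_cons Qi.
by rewrite -IH; apply: period_ext => u _; rewrite big_cons Qi.
Qed.

(** Up to a numerical factor the constant is the sum of the absolute values of
    the coefficients, each multiplied by a bound of the Jacobian determinant of
    its cube. *)
Lemma period_bound : exists2 K : R, 0 <= K & forall f (M : R), 0 <= M ->
  chain_cont Z f -> (forall u, carrier Z u -> `|f u| <= M%:C) ->
  `|period g f Z| <= (K * M)%:C.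
Proof.
suff [K K0 KP] : exists2 K : R, 0 <= K & forall f (M : R), 0 <= M ->
    chain_cont Z f -> (forall u, carrier Z u -> `|f u| <= M%:C) ->
    `|chain_int g f Z| <= (K * M)%:C.
  pose w : R[i] := ((2 * pi)%:C * 'i%C) ^- r.
  pose A := Num.sqrt (complex.Re w ^+ 2 + complex.Im w ^+ 2).
  have AE : `|w| = A%:C by rewrite normc_def.
  exists (A * K); first by rewrite mulr_ge0// sqrtr_ge0.
  move=> f M M0 cf fM; rewrite /period normrM -/w AE -mulrA rmorphM /=.
  by rewrite ler_wpM2l ?ler0c ?sqrtr_ge0//; exact: KP.
elim: Z C1Z => [|x Y IH] C1Y.
  exists 0 => // f M M0 _ _; rewrite /chain_int big_nil normr0 mul0r.
  by [].
have [|K K0 KP] := IH; first by move=> y yY; apply: C1Y; rewrite inE yY orbT.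
have xY : x \in x :: Y by rewrite inE eqxx.
have cj := cube_cont_jacdet g (C1Y x xY).
have [t0 t0c t0M] := cube_cont_max cj.
set w := jacdet g x.2 t0 in t0M.
pose N := Num.sqrt (complex.Re w ^+ 2 + complex.Im w ^+ 2).
have NE : `|w| = N%:C by rewrite normc_def.
have N0 : 0 <= N by exact: sqrtr_ge0.
exists (`|x.1| * (2 * N) + K); first by rewrite addr_ge0// !mulr_ge0.
move=> f M M0 cf fM; rewrite /chain_int big_cons mulrDl rmorphD /=.
apply: le_trans (ler_normD _ _) _; apply: lerD; last first.
  apply: KP => //; first by move=> y yY; apply: cf; rewrite inE yY orbT.
  by move=> u [y yY tu]; apply: fM; exists y => //; rewrite inE yY orbT.
rewrite normrM -!mulrA rmorphM /=; apply: ler_pM => //.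
  by rewrite normc_def /= expr0n addr0 sqrtr_sqr lecR.
apply: Ccube_bound; first exact: cube_contM (cf x xY) cj.
move=> t tc; rewrite normrM mulrC rmorphM /= -NE.
by apply: ler_pM => //; [exact: t0M | apply: fM; exact: carrierP].
Qed.
End Period.
End ChainIntegral.

(** * Linear forms on the complexification *)

Section LinearForms.
Set Implicit Arguments.
Unset Strict Implicit.
Context {R : realType} {a : vectType R}.
Local Notation dual := 'Hom(a, R^o).

Lemma cform_lin (t : R) (xi eta : dual) u :
  cform (t *: xi + eta) u = t%:C * cform xi u + cform eta u.
Proof.
rewrite /cform !add_lfunE !scale_lfunE /=; apply/eqP; rewrite eq_complex /=.
by rewrite !mul0r subr0 addr0 !eqxx.
Qed.

Lemma cform0 u : cform (0 : dual) u = 0.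
Proof. by rewrite /cform !zero_lfunE. Qed.

Lemma cform_sum (I : Type) (s : seq I) (b : I -> R) (F : I -> dual) u :
  cform (\sum_(i <- s) b i *: F i) u = \sum_(i <- s) (b i)%:C * cform (F i) u.
Proof.
elim: s => [|i s IH]; first by rewrite !big_nil cform0.
by rewrite !big_cons cform_lin IH.
Qed.

Lemma cform_scale (xi : dual) t u : cform xi (cplx_scale t u) = t * cform xi u.
Proof.
rewrite /cform /cplx_scale /= linearB !linearD !linearZ /=.
case: t => t1 t2 /=; congr (_ +i* _); first by rewrite scalerN.
by rewrite addrC.
Qed.

Context {r : nat} (g : r.-tuple a).

Definition coord_form (j : 'I_r) : dual := linfun (coord g j : a -> R^o).

Lemma ccoordE j u : ccoord g j u = cform (coord_form j) u.
Proof. by rewrite /ccoord /cform !lfunE. Qed.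

Hypothesis hg : basis_of fullv g.

Lemma dim_dual : \dim (fullv : {vspace dual}) = r.
Proof.
rewrite dimvf -[RHS](vector.size_basis hg) dimvf.
by rewrite /dim /= muln1.
Qed.

(** The forms coord_form g j are the basis dual to g. *)
Lemma dual_expand (xi : dual) :
  xi = \sum_j (xi (tnth g j) : R) *: coord_form j.
Proof.
apply/lfunP => v; rewrite sum_lfunE {1}(coord_basis hg (memvf v)) linear_sum.
apply: eq_bigr => j _; rewrite scale_lfunE lfunE linearZ /= (tnth_nth 0).
exact: mulrC.
Qed.

Definition form_poly (xi : dual) : {mpoly R[i][r]} :=
  \sum_j (xi (tnth g j) : R)%:C *: 'X_j.

Lemma form_polyE xi u : (form_poly xi).@[fun j => ccoord g j u] = cform xi u.
Proof.
rewrite {2}(dual_expand xi) cform_sum /form_poly raddf_sum.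
by apply: eq_bigr => j _; rewrite /= mevalZ mevalXU ccoordE.
Qed.

End LinearForms.

(** * Vanishing of the Jeffrey-Kirwan functional *)

Section Residue.
Set Implicit Arguments.
Unset Strict Implicit.
Context {R : realType} {a : vectType R} {r n : nat}.
Context (g : r.-tuple a) (hg : basis_of fullv g).
Local Notation dual := 'Hom(a, R^o).
Context (alpha : n.-tuple dual).
Local Notation U := (Ucompl alpha).
Local Notation al i := (tnth alpha i).
Local Notation frac := (fraction g alpha).

Lemma fraction_ratA Q m : ratA g alpha (frac Q m).
Proof. by exists Q, m. Qed.

Lemma prod_cform_neq0 (m : 'I_n -> nat) u : U u ->
  \prod_i cform (al i) u ^+ m i != 0.
Proof. by move=> Uu; apply/prodf_neq0 => i _; rewrite expf_neq0// Uu. Qed.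

(** Over the common denominator the numerators are multiplied by products of the
    alpha_i, written as polynomials in the coordinates. *)
Lemma ratA_lin b f1 f2 : ratA g alpha f1 -> ratA g alpha f2 ->
  ratA g alpha (fun u => b * f1 u + f2 u).
Proof.
move=> [Q1 [m1 e1]] [Q2 [m2 e2]].
exists (b *: (Q1 * \prod_i form_poly g (al i) ^+ m2 i) +
        Q2 * \prod_i form_poly g (al i) ^+ m1 i), (fun i => m1 i + m2 i)%N.
move=> u Uu; rewrite e1// e2// /fraction.
rewrite mevalD mevalZ !mevalM !rmorph_prod /=.
under [X in _ = _ / X]eq_bigr do rewrite exprD.
rewrite big_split /=.
under [X in (b * (_ * X) + _) / _]eq_bigr do rewrite rmorphXn /= form_polyE//.
under [X in (_ + _ * X) / _]eq_bigr do rewrite rmorphXn /= form_polyE//.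
have := prod_cform_neq0 m1 Uu; have := prod_cform_neq0 m2 Uu.
set X1 := \prod_i _; set X2 := \prod_i _ => n1 n2.
by field; rewrite n1 n2.
Qed.

Context (c : set (dual_top g)) (J : (cplx a -> R[i]) -> R[i]).
Hypothesis hJ : is_JK alpha c J.

Lemma JK_ext f1 f2 : ratA g alpha f1 -> (forall u, U u -> f1 u = f2 u) ->
  J f1 = J f2.
Proof. by case: hJ => -[ext _] _ _ _; exact: ext. Qed.

Lemma JK_lin b f1 f2 : ratA g alpha f1 -> ratA g alpha f2 ->
  J (fun u => b * f1 u + f2 u) = b * J f1 + J f2.
Proof. by case: hJ => -[_ lin] _ _ _; exact: lin. Qed.

Lemma JK_sum0 (I : eqType) (s : seq I) (b : I -> R[i]) (f : I -> cplx a -> R[i]) :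
  (forall i, i \in s -> ratA g alpha (f i) /\ J (f i) = 0) ->
  ratA g alpha (fun u => \sum_(i <- s) b i * f i u) /\
  J (fun u => \sum_(i <- s) b i * f i u) = 0.
Proof.
elim: s => [|i s IH] fs.
  have r0 : ratA g alpha (fun=> 0).
    by exists 0, (fun=> 0%N) => u _; rewrite /fraction meval0 mul0r.
  have e0 : (fun u => \sum_(i <- [::]) b i * f i u) = (fun=> 0).
    by apply/funext => u; rewrite big_nil.
  rewrite e0; split=> //.
  have := JK_lin (-1) r0 r0; rewrite [X in _ = X + _]mulN1r [RHS]addNr => J0; rewrite -[RHS]J0.
  by congr J; apply/funext => u; rewrite mulr0 addr0.
have [|ih1 ih2] := IH; first by move=> j js; apply: fs; rewrite inE js orbT.
have [ri Ji] := fs i (mem_head _ _).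
have -> : (fun u => \sum_(j <- i :: s) b j * f j u) =
    (fun u => b i * f i u + \sum_(j <- s) b j * f j u).
  by apply/funext => u; rewrite big_cons.
by split; [exact: ratA_lin | rewrite JK_lin// Ji ih2 mulr0 addr0].
Qed.

Lemma fraction1_homog m :
  homogeneous alpha (- (\sum_i m i)%N%:Z) (frac 1 m).
Proof.
move=> t u t0 Uu; rewrite /fraction meval1 mul1r.
under eq_bigr do rewrite cform_scale exprMn.
rewrite big_split /= invfM; congr (_ * _).
  by rewrite -exprnN -expr_sum.
by rewrite meval1 mul1r.
Qed.

(** By homogeneity only the case of total degree r matters.  Since the forms
    span, the multiset of the r forms of the denominator is then a basis. *)
Lemma JK_const (S : 'I_n -> Prop) m :
  (forall sigma : r.-tuple 'I_n, basis_index alpha sigma -> (forall k, S (tnth sigma k)) ->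
     ~ (c `<=` ccone (subfamily alpha sigma))) ->
  (forall i, m i != 0%N -> S i) ->
  span [seq al i | i <- enum 'I_n & m i != 0%N] = fullv ->
  J (frac 1 m) = 0.
Proof.
move=> noS mS sp.
have [N_r|N_r] := eqVneq (\sum_i m i)%N r; last first.
  have [_ _ hom _] := hJ.
  apply: hom (fraction_ratA _ _) (fraction1_homog m) _.
  by rewrite eqr_opp.
(* As the total degree is r, listing each index i with multiplicity m i gives
   an r-tuple. *)
pose s := flatten [seq nseq (m i) i | i <- enum 'I_n].
have szs : size s == r.
  rewrite size_flatten /shape -map_comp -N_r sumnE big_map big_enum /=.
  by apply/eqP; apply: eq_bigr => i _; rewrite size_nseq.
have s_mem i : (i \in s) = (m i != 0%N).
  apply/flattenP/idP => [[y /mapP[j _ ->]]|mi].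
    by rewrite mem_nseq lt0n => /andP[mj /eqP ->].
  exists (nseq (m i) i); last by rewrite mem_nseq eqxx lt0n mi.
  by apply/mapP; exists i; rewrite ?mem_enum.
pose sigma := Tuple szs.
have sigma_mem k : m (tnth sigma k) != 0%N by rewrite -s_mem; exact: mem_tnth.
have bs : basis_index alpha sigma.
  rewrite /basis_index basisEdim size_tuple (dim_dual hg) leqnn andbT -sp.
  apply/span_subvP => xi xiD; have [i + ->] := mapP xiD.
  rewrite mem_filter => /andP[mi _].
  apply: memv_span; rewrite -s_mem in mi.
  have /tnthP[k ->] : i \in sigma by [].
  by apply/mapP; exists k; rewrite ?mem_enum.
have [_ bas _ _] := hJ.
have := bas _ bs; case: asboolP => [/(noS _ bs)[]//|_].
  by move=> k; exact: mS.
move=> <-; apply: JK_ext; first exact: fraction_ratA.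
move=> u Uu; rewrite /fraction meval1 mul1r; congr (_^-1).
under [RHS]eq_bigr do rewrite tnth_mktuple.
rewrite -(big_tuple _ _ sigma xpredT (fun i => cform (al i) u)) /=.
rewrite big_flatten big_map big_enum /=; apply: eq_bigr => i _.
by rewrite big_nseq iter_mulr_1.
Qed.

(** The coefficients are attached to the entries of a list, since the forms at
    different indices may coincide. *)
Lemma span_map_expand (s : seq 'I_n) (xi : dual) :
  xi \in span [seq al i | i <- s] ->
  exists2 I : seq (R * 'I_n), {in I, forall p, p.2 \in s} &
    xi = \sum_(p <- I) p.1 *: al p.2.
Proof.
elim: s xi => [|i s IH] xi /=.
  by rewrite span_nil memv0 => /eqP ->; exists [::]; rewrite ?big_nil.
rewrite span_cons => /memv_addP[_ /vlineP[k ->] [w /IH[I Im ->] ->]].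
exists ((k, i) :: I); last by rewrite big_cons.
by move=> p; rewrite !inE => /orP[/eqP ->|/Im ->]; rewrite ?eqxx ?orbT.
Qed.

(** Induction on the order of the denominator.  Either its forms do not span the
    dual space, or each coordinate occurring in the numerator is a
    combination of them and lowers that order; JK_const is the base case. *)
Lemma JK_vanish (S : 'I_n -> Prop) m Q :
  (forall sigma : r.-tuple 'I_n, basis_index alpha sigma -> (forall k, S (tnth sigma k)) ->
     ~ (c `<=` ccone (subfamily alpha sigma))) ->
  (forall i, m i != 0%N -> S i) ->
  J (frac Q m) = 0.
Proof.
move=> noS; have [N] := ubnP (\sum_i m i)%N.
elim: N => // N IH in m Q *; rewrite ltnS => mN mS.
have [sp|nsp] := eqVneq (span [seq al i | i <- enum 'I_n & m i != 0%N]) fullv;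
  last by have [_ _ _] := hJ; apply.
suff mono mm : J (frac 'X_[mm] m) = 0.
  have [|_ J0] := @JK_sum0 _ (msupp Q) (fun mm => Q@_mm) (fun mm => frac 'X_[mm] m).
    by move=> mm _; split; [exact: fraction_ratA | exact: mono].
  rewrite -J0; apply: JK_ext (fraction_ratA _ _) _ => u _.
  rewrite /fraction {1}(mpolyE Q) raddf_sum mulr_suml; apply: eq_bigr => mm _.
  by rewrite /= mevalZ mulrA.
have [->|mm0] := eqVneq mm 0%MM; first by rewrite mpolyX0; exact: JK_const noS mS sp.
have [j mmj] : exists j, mm j != 0%N.
  apply/existsP; rewrite -negb_forall; apply: contra mm0 => /forallP h.
  by apply/eqP/mnmP => i; rewrite mnm0E; exact/eqP/h.
have jle : (U_(j) <= mm)%MM.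
  by apply/mnm_lepP => i; rewrite mnm1E; case: eqP => // <-; rewrite lt0n.
set mm' := (mm - U_(j))%MM.
have : coord_form g j \in span [seq al i | i <- enum 'I_n & m i != 0%N].
  by rewrite sp memvf.
move=> /span_map_expand[I Im xiE].
have [|_ J0] := @JK_sum0 _ I (fun p => p.1%:C)
    (fun p => frac 'X_[mm'] (fun i => m i - (i == p.2))%N).
  move=> p /Im; rewrite mem_filter => /andP[mp _]; split; first exact: fraction_ratA.
  apply: IH => [|i mi]; last by apply: mS; move: mi; apply: contra => /eqP ->.
  apply: leq_trans mN; rewrite (bigD1 p.2)//= [X in (_ < X)%N](bigD1 p.2)//= eqxx.
  rewrite -addSn leq_add//; first by rewrite subn1 prednK// lt0n.
  by apply: leq_sum => i _; exact: leq_subr.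
rewrite -J0; apply: JK_ext (fraction_ratA _ _) _ => u Uu.
rewrite /fraction -(submK jle) mulrC mpolyXD mevalM mevalXU ccoordE xiE.
rewrite cform_sum mulr_sumr mulr_sumr; apply: eq_big_seq => p /Im.
rewrite mem_filter => /andP[mp _].
rewrite [in LHS](bigD1 p.2)//= [in RHS](bigD1 p.2)//= eqxx subn1.
have -> : \prod_(i | i != p.2) cform (al i) u ^+ (m i - (i == p.2)) =
    \prod_(i | i != p.2) cform (al i) u ^+ m i.
  by apply: eq_bigr => i /negbTE ->; rewrite subn0.
rewrite -[in LHS](prednK (n := m p.2)) ?lt0n// exprS.
have : \prod_(i | i != p.2) cform (al i) u ^+ m i != 0.
  by apply/prodf_neq0 => i _; rewrite expf_neq0// Uu.
have := Uu p.2; have := expf_neq0 (m p.2).-1 (Uu p.2).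
set x := _ ^+ _; set y := cform _ u; set w := bigop _ _ _; set e := meval _ _.
by move=> x0 y0 w0; field; rewrite x0 y0 w0.
Qed.
End Residue.

(** * The coefficients of the generating series *)

Section SmallNumbers.
Set Implicit Arguments.
Unset Strict Implicit.
Context {R : realType}.

Lemma expr_small (rho C eps : R) : 0 <= rho -> rho < 1 -> 0 < eps ->
  exists N : nat, C * rho ^+ N < eps.
Proof.
move=> rho0 rho1 eps0.
have /cvgrPdist_lt cv : (fun k => C * rho ^+ k) @ \oo --> (0 : R).
  rewrite -[X in _ --> X](mulr0 C); apply: cvgMl_tmp.
  by apply: cvg_expr; rewrite ger0_norm.
have [N _ HN] := cv _ eps0; exists N.
apply: le_lt_trans (HN N _); last exact: leqnn.
by rewrite sub0r normrN ler_norm.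
Qed.

(** A nonnegative real below every positive one is 0; this form matches the
    error terms of the approximations below. *)
Lemma eq0_small (x : R[i]) : (forall eps : R, 0 < eps -> `|x| <= eps%:C) -> x = 0.
Proof.
rewrite normc_def => xe; apply/eqP; rewrite -normr_eq0 normc_def.
set y := Num.sqrt _ in xe *.
have y0 : 0 <= y by exact: sqrtr_ge0.
suff -> : y = 0 by [].
apply/eqP; rewrite eq_le y0 andbT leNgt; apply/negP => yp.
have : y / 2 < y by rewrite gtr_pMr// invf_lt1// ltr1n.
by rewrite ltNge -lecR xe// divr_gt0.
Qed.

End SmallNumbers.

Section Bracket.
Set Implicit Arguments.
Unset Strict Implicit.
Context {R : realType} {a : vectType R} {r n : nat}.
Context (g : r.-tuple a) (hg : basis_of fullv g).
Local Notation dual := 'Hom(a, R^o).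
Context (alpha : n.-tuple dual).
Local Notation U := (Ucompl alpha).
Local Notation al i := (tnth alpha i).
Local Notation frac := (fraction g alpha).
Context (P : {mpoly R[i][n]}).

(** The integrand of the coefficient of z^l in the generating series. *)
Definition bracket_form (l : a) (u : cplx a) : R[i] :=
  evalP alpha P u / ((1 - cform (kappa alpha) u) * pfun alpha l u *
                           \prod_i cform (al i) u).

(** The k-th term of bracket_form in the expansion of 1 / (1 - kappa). *)
Definition bracket_term (l : a) (k : nat) (u : cplx a) : R[i] :=
  evalP alpha P u * cform (kappa alpha) u ^+ k /
    (pfun alpha l u * \prod_i cform (al i) u).

(** The exponent of alpha_i in 1 / (p_l prod alpha_i) is the opposite of
    <alpha_i, l> + 1; pole_order and zero_order are its negative and positive
    parts. *)
Definition pole_order (l : a) (i : 'I_n) : nat :=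
  if (Num.floor (al i l : R) + 1)%R is Posz p then p else 0%N.

Definition zero_order (l : a) (i : 'I_n) : nat :=
  if (Num.floor (al i l : R) + 1)%R is Negz p then p.+1 else 0%N.

Lemma pfun_neq0 l u : U u -> pfun alpha l u != 0.
Proof. by move=> Uu; apply/prodf_neq0 => i _; rewrite expfz_neq0// Uu. Qed.

Lemma prod_form_neq0 u : U u -> \prod_i cform (al i) u != 0.
Proof. by move=> Uu; apply/prodf_neq0 => i _; rewrite Uu. Qed.

(** P kappa^k / (p_l prod alpha_i) has no pole along alpha_i when
    <alpha_i, l> < 0: such an alpha_i goes to the numerator. *)
Lemma bracket_term_fraction l k :
  exists Q, forall u, U u -> bracket_term l k u = frac Q (pole_order l) u.
Proof.
exists ((P \mPo [tuple form_poly g (al i) | i < n]) *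
  form_poly g (kappa alpha) ^+ k * \prod_i form_poly g (al i) ^+ zero_order l i).
move=> u Uu; rewrite /bracket_term /fraction !mevalM rmorphXn rmorph_prod /=.
rewrite comp_mpoly_meval form_polyE//.
have -> : P.@[fun i => (tnth [tuple form_poly g (al i0)  | i0 < n] i).@[(ccoord g)^~ u]] =
    evalP alpha P u.
  by apply: meval_eq => i; rewrite tnth_mktuple form_polyE.
rewrite -!mulrA; congr (_ * (_ * _)).
under [X in _ = X / _]eq_bigr do rewrite rmorphXn /= form_polyE//.
rewrite /pfun -big_split -!prodfV -big_split /=; apply: eq_bigr => i _.
have y0 := Uu i; set y := cform _ u in y0 *.
rewrite -{2}[y]expr1z -expfzDr// /zero_order /pole_order.
case: (_ + 1) => p; first by rewrite expr0 mul1r.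
by rewrite expr0 invr1 mulr1 NegzE -exprnN invrK.
Qed.

Lemma pole_order_ge0 l i : pole_order l i != 0%N -> 0 <= (al i l : R).
Proof.
rewrite /pole_order; case E : (_ + 1) => [p|//] p0.
rewrite -[0]/(0%:~R) -floor_ge_int -(lerD2r 1) E add0r.
by rewrite lez_nat lt0n.
Qed.

Context (c : set (dual_top g)) (J : (cplx a -> R[i]) -> R[i]).
Hypothesis hJ : is_JK alpha c J.

(** If c were contained in the cone of a basis of forms alpha_i with
    <alpha_i, l> >= 0, then l would be nonnegative on c. *)
Lemma JK_bracket_term0 l k : ~ polar c l -> J (bracket_term l k) = 0.
Proof.
move=> npol; have [Q QE] := bracket_term_fraction l k.
rewrite (_ : J _ = J (frac Q (pole_order l))).
  apply: (JK_vanish hg hJ (S := fun i => 0 <= (al i l : R))); last exact: pole_order_ge0.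
  move=> sigma _ sig cs; apply: npol => xi /cs[t t0 ->].
  rewrite sum_lfunE; apply: sumr_ge0 => k' _; rewrite scale_lfunE mulr_ge0//.
  by rewrite tnth_mktuple; exact: sig.
by apply: (JK_ext hJ) => //; exists Q, (pole_order l).
Qed.

Section Cycle.
Context (Z : cchain a r).
Hypothesis C1Z : forall x, x \in Z -> C1_cube x.2.
Hypothesis suppZ : carrier Z `<=` U `&` kappa_disc alpha.
Hypothesis hZ : forall f, ratA g alpha f -> J f = period g f Z.

Let cc xi := chain_cont_cform xi C1Z.

Lemma one_sub_kappa_neq0 u : carrier Z u -> 1 - cform (kappa alpha) u != 0.
Proof.
move=> /suppZ[_]; rewrite /kappa_disc /= subr_eq0; apply: contraTneq => <-.
by rewrite normr1 ltxx.
Qed.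

Lemma chain_cont_evalP : chain_cont Z (evalP alpha P).
Proof.
rewrite /evalP; apply: (chain_cont_ext (f2 := fun u =>
  \sum_(m <- msupp P) P@_m * \prod_i cform (al i) u ^+ m i)).
  by move=> u _; rewrite mevalE.
apply: chain_cont_sum => m; apply: chain_contM; first exact: chain_contC.
by apply: chain_cont_prod => i; apply: chain_contX.
Qed.

Lemma chain_cont_pfun l : chain_cont Z (pfun alpha l).
Proof.
apply: chain_cont_prod => i; apply: chain_contXz => // u /suppZ[Uu _].
exact: Uu.
Qed.

Lemma chain_cont_bracket_form l : chain_cont Z (bracket_form l).
Proof.
apply: chain_contM; first exact: chain_cont_evalP.
apply: (chain_contV (f := fun u => (1 - cform (kappa alpha) u) * pfun alpha l u *
                           \prod_i cform (al i) u)).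
  move=> u Zu; have [Uu _] := suppZ Zu.
  by rewrite !mulf_neq0 ?pfun_neq0 ?prod_form_neq0 ?one_sub_kappa_neq0.
apply: chain_contM; last by apply: chain_cont_prod.
apply: chain_contM; last exact: chain_cont_pfun.
by apply: chain_contB => //; exact: chain_contC.
Qed.

(** Finite geometric expansion of 1 / (1 - kappa) with its remainder.  The terms
    belong to the space on which the periods of the class are given by J, while
    bracket_form itself does not. *)
Lemma period_bracket_form l N : period g (bracket_form l) Z =
  \sum_(k < N) J (bracket_term l k) +
  period g (fun u => cform (kappa alpha) u ^+ N * bracket_form l u) Z.
Proof.
elim: N => [|N IH].
  by rewrite big_ord0 add0r; apply: period_ext => u _; rewrite expr0 mul1r.
have ratT : ratA g alpha (bracket_term l N).
  by have [Q QE] := bracket_term_fraction l N; exists Q, (pole_order l).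
have cont_rem k : chain_cont Z (fun u => cform (kappa alpha) u ^+ k * bracket_form l u).
  by apply: chain_contM; [exact: chain_contX | exact: chain_cont_bracket_form].
have E u : carrier Z u -> cform (kappa alpha) u ^+ N * bracket_form l u =
    bracket_term l N u + cform (kappa alpha) u ^+ N.+1 * bracket_form l u.
  move=> Zu; have [Uu _] := suppZ Zu; rewrite /bracket_term /bracket_form exprS.
  have := pfun_neq0 l Uu; have := prod_form_neq0 Uu; have := one_sub_kappa_neq0 Zu.
  set x := cform _ u; set y := pfun _ _ _; set w := bigop _ _ _ => x1 w0 y0.
  by field; rewrite x1 y0 w0.
rewrite IH big_ord_recr /= -addrA; congr (_ + _); rewrite hZ//.
rewrite -[period g (bracket_term l N) Z]mul1r -period_lin//.
  by apply: period_ext => u Zu; rewrite mul1r E.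
apply: (chain_cont_ext (f2 := fun u => cform (kappa alpha) u ^+ N * bracket_form l u +
  - (cform (kappa alpha) u ^+ N.+1 * bracket_form l u))).
  by move=> u Zu; rewrite E// addrK.
by apply: chain_contB.
Qed.

Lemma period_bracket_approx l eps : 0 < eps -> exists N0, forall N, (N0 <= N)%N ->
  `|period g (bracket_form l) Z - \sum_(k < N) J (bracket_term l k)| <= eps%:C.
Proof.
move=> eps0.
have [rho rho0 [rhoM rho1]] := chain_cont_bound (cc (kappa alpha)).
have {}rho1 : rho < 1 by apply: rho1 => // u /suppZ[].
have [B B0 [BM _]] := chain_cont_bound (chain_cont_bracket_form l).
have [K K0 KP] := period_bound g C1Z.
have [N0 HN0] := expr_small (K * B) rho0 rho1 eps0.
exists N0 => N N0N; rewrite (period_bracket_form l N) addrAC subrr add0r.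
apply: (@le_trans _ _ ((K * (rho ^+ N * B))%:C)).
  apply: KP; first by rewrite mulr_ge0// exprn_ge0.
    by apply: chain_contM; [exact: chain_contX | exact: chain_cont_bracket_form].
  move=> u Zu; rewrite normrM normrX rmorphM rmorphXn /=; apply: ler_pM => //.
    by apply: lerXn2r; rewrite ?nnegrE ?normr_ge0 ?ler0c//; exact: rhoM.
  exact: BM.
rewrite lecR (le_trans _ (ltW HN0))// mulrCA mulrC ler_wpM2l ?mulr_ge0//.
by rewrite -(subnKC N0N) exprD ler_piMr ?exprn_ge0// exprn_ile1// ltW.
Qed.

Lemma period_bracket0 l : ~ polar c l -> period g (bracket_form l) Z = 0.
Proof.
move=> npol; apply: eq0_small => eps eps0.
have [N /(_ N (leqnn _))] := period_bracket_approx l eps0.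
by rewrite big1 ?subr0// => k _; rewrite JK_bracket_term0.
Qed.
End Cycle.

(** Both periods are the limit of the same sequence, written in terms of J. *)
Lemma period_bracket_unique (Z1 Z2 : cchain a r) l :
  (forall x, x \in Z1 -> C1_cube x.2) -> (forall x, x \in Z2 -> C1_cube x.2) ->
  carrier Z1 `<=` U `&` kappa_disc alpha -> carrier Z2 `<=` U `&` kappa_disc alpha ->
  (forall f, ratA g alpha f -> J f = period g f Z1) ->
  (forall f, ratA g alpha f -> J f = period g f Z2) ->
  period g (bracket_form l) Z1 = period g (bracket_form l) Z2.
Proof.
move=> C1 C2 s1 s2 h1 h2; apply/eqP; rewrite -subr_eq0; apply/eqP.
apply: eq0_small => eps eps0; have eps2 : 0 < eps / 2 by rewrite divr_gt0.
have [N1 H1] := period_bracket_approx C1 s1 h1 l eps2.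
have [N2 H2] := period_bracket_approx C2 s2 h2 l eps2.
pose N := maxn N1 N2; have := H1 N (leq_maxl _ _); have := H2 N (leq_maxr _ _).
move=> e2 e1; rewrite (splitr eps) rmorphD /=.
rewrite -(subrKA (\sum_(k < N) J (bracket_term l k))).
apply: le_trans (ler_normD _ _) _; apply: lerD => //.
by rewrite distrC.
Qed.
End Bracket.

(** * Partial sums of a product of geometric series *)

Section BoxSums.
Set Implicit Arguments.
Unset Strict Implicit.
Context {K : numFieldType}.

Lemma norm_prod_le (I : Type) (s : seq I) (x : I -> K) B :
  (forall j, `|x j| <= B) -> `|\prod_(j <- s) x j| <= B ^+ size s.
Proof.
move=> xB; elim: s => [|j s IH]; first by rewrite big_nil normr1 expr0.
by rewrite big_cons normrM exprS; apply: ler_pM.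
Qed.

(** Telescoping: the factors are replaced one at a time. *)
Lemma prod_diff_le (I : Type) (s : seq I) (x y : I -> K) B d :
  1 <= B -> 0 <= d ->
  (forall j, `|x j| <= B) -> (forall j, `|y j| <= B) ->
  (forall j, `|x j - y j| <= d) ->
  `|\prod_(j <- s) x j - \prod_(j <- s) y j| <= (size s)%:R * (B ^+ size s * d).
Proof.
move=> B1 d0 xB yB xyd; have B0 : 0 <= B := le_trans ler01 B1.
elim: s => [|j s IH]; first by rewrite !big_nil subrr normr0 mul0r.
rewrite !big_cons /=.
rewrite (_ : _ - _ = (x j - y j) * \prod_(i <- s) x i +
  y j * (\prod_(i <- s) x i - \prod_(i <- s) y i)); last first.
  by rewrite mulrBl mulrBr addrA subrK.
apply: le_trans (ler_normD _ _) _; rewrite !normrM -natr1 mulrDl mul1r addrC.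
apply: lerD.
  rewrite exprS -mulrA mulrCA; apply: ler_pM => //.
rewrite mulrC; apply: ler_pM => //; apply: le_trans (norm_prod_le s xB) _.
by rewrite exprS ler_peMl// exprn_ge0.
Qed.

Definition geom (x : K) M := \sum_(i < M) x ^+ i.

Lemma geomE x M : (1 - x) * geom x M = 1 - x ^+ M.
Proof. by rewrite -[RHS]opprB subrX1 -mulNr opprB. Qed.

Lemma geom_le rho M : 0 <= rho -> rho < 1 -> geom rho M <= (1 - rho)^-1.
Proof.
move=> rho0 rho1; have p : 0 < 1 - rho by rewrite subr_gt0.
by rewrite -[leRHS]mulr1 ler_pdivlMl// geomE gerBl exprn_ge0.
Qed.

Lemma norm_geom_le x rho M : `|x| <= rho -> `|geom x M| <= geom rho M.
Proof.
move=> xr; apply: le_trans (ler_norm_sum _ _ _) _; apply: ler_sum => i _.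
rewrite normrX; apply: lerXn2r => //; rewrite nnegrE //.
exact: le_trans xr.
Qed.

(** Comparison with the box of side M: the partial sum over the whole box is a
    product of finite geometric sums, hence close to the full product.  What A
    misses in the box lies outside the box of side N, and is bounded by the
    difference of the two products of finite geometric sums in rho. *)
Lemma box_sum_approx r N M (rho : K) (w : 'I_r -> K)
    (A : pred {ffun 'I_r -> 'I_M}) :
  0 <= rho -> rho < 1 -> (N <= M)%N -> (forall j, `|w j| <= rho) ->
  (forall f : {ffun 'I_r -> 'I_M}, (forall j, (f j < N)%N) -> A f) ->
  `|\prod_j (1 - w j)^-1 - \sum_(f | A f) \prod_j w j ^+ f j| <=
  2 * (r%:R * ((1 - rho)^-1 ^+ r * (rho ^+ N * (1 - rho)^-1))).
Proof.
move=> rho0 rho1 NM wr AN; set B := (1 - rho)^-1.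
have p : 0 < 1 - rho by rewrite subr_gt0.
have B1 : 1 <= B by rewrite invf_ge1// gerBl.
have B0 : 0 <= B by exact: le_trans B1.
have d0 : 0 <= rho ^+ N * B by rewrite mulr_ge0// exprn_ge0.
have w1 j : 1 - rho <= `|1 - w j|.
  apply: le_trans (lerB_normD _ _); rewrite normr1 normrN lerD2l lerN2.
  exact: wr.
have wn j : 1 - w j != 0.
  by rewrite -normr_gt0; exact: lt_le_trans (w1 j).
have wV j : `|(1 - w j)^-1| <= B.
  by rewrite normfV lef_pV2 ?posrE// normr_gt0.
have := @prod_diff_le _ (index_enum 'I_r) (fun j => (1 - w j)^-1)
  (fun j => geom (w j) M) B (rho ^+ N * B) B1 d0.
have szr : size (index_enum 'I_r) = r by rewrite -sum1_size big_const_ord iter_addn_0 mul1n.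
rewrite szr => D1.
have {}D1 : `|\prod_j (1 - w j)^-1 - \prod_j geom (w j) M| <=
    r%:R * (B ^+ r * (rho ^+ N * B)).
  apply: D1 => // j.
    by apply: le_trans (norm_geom_le _ (wr j)) _; exact: geom_le.
  rewrite (_ : _ - _ = w j ^+ M * (1 - w j)^-1); last first.
    apply: (mulfI (wn j)); rewrite mulrBr geomE mulfV// mulrCA mulfV// mulr1.
    by rewrite opprB addrC subrK.
  rewrite normrM normrX; apply: ler_pM => //.
  apply: (@le_trans _ _ (rho ^+ M)).
    by apply: lerXn2r => //; rewrite nnegrE.
  by rewrite -(subnKC NM) exprD ler_piMr ?exprn_ge0// exprn_ile1// ltW.
have := @prod_diff_le _ (index_enum 'I_r) (fun j => geom rho M)
  (fun j => geom rho N) B (rho ^+ N * B) B1 d0.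
rewrite szr => D2.
have geom0 L : 0 <= geom rho L by apply: sumr_ge0 => i _; exact: exprn_ge0.
have geomNM : geom rho M = geom rho N + rho ^+ N * geom rho (M - N).
  rewrite /geom -(subnKC NM) big_split_ord /= mulr_sumr; congr (_ + _).
  by rewrite addKn; apply: eq_bigr => i _; rewrite exprD.
have {}D2 : \prod_(j < r) geom rho M - \prod_(j < r) geom rho N <=
    r%:R * (B ^+ r * (rho ^+ N * B)).
  apply: le_trans (real_ler_norm _) _.
    by rewrite rpredB// ger0_real// prodr_ge0.
  apply: D2 => j; rewrite ?ger0_norm ?geom_le//.
    by rewrite geomNM addrAC subrr add0r ler_wpM2l ?exprn_ge0// geom_le.
  by rewrite geomNM addrAC subrr add0r mulr_ge0// exprn_ge0.
have expand (v : 'I_r -> K) : \prod_j geom (v j) M =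
    \sum_(f : {ffun 'I_r -> 'I_M}) \prod_j v j ^+ f j.
  by rewrite /geom bigA_distr_bigA.
have small : \prod_(j < r) geom rho N =
    \sum_(f : {ffun 'I_r -> 'I_M} | [forall j, (f j < N)%N]) \prod_(j < r) rho ^+ f j.
  have -> : geom rho N = \sum_(i < M | (i < N)%N) rho ^+ i.
    by rewrite /geom (big_ord_widen _ (fun i => rho ^+ i) NM).
  rewrite (bigA_distr_big _ (fun _ i => rho ^+ nat_of_ord i)) /=.
  apply: eq_bigl => f; apply/ffun_onP/forallP => h j; exact: h.
have D3 : `|\prod_j geom (w j) M - \sum_(f | A f) \prod_j w j ^+ f j| <=
    r%:R * (B ^+ r * (rho ^+ N * B)).
  apply: le_trans D2; rewrite expand (bigID A) /= addrAC subrr add0r.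
  apply: le_trans (ler_norm_sum _ _ _) _.
  rewrite (expand (fun=> rho)) small.
  rewrite [X in X - _](bigID
    (fun f : {ffun 'I_r -> 'I_M} => [forall j, (f j < N)%N])) /=.
  rewrite addrAC subrr add0r.
  rewrite [leRHS](bigID A) /= -[leLHS]add0r; apply: lerD.
    by apply: sumr_ge0 => f _; apply: prodr_ge0 => j _; exact: exprn_ge0.
  rewrite [leRHS](eq_bigl (fun f => ~~ A f)); last first.
    move=> f; apply/andP/idP => [[]//|nA]; split=> //; apply: contra nA.
    by move=> /forallP; exact: AN.
  apply: ler_sum => f _; rewrite normr_prod; apply: ler_prod => j _.
  by rewrite normr_ge0 normrX lerXn2r// nnegrE.
rewrite mulr_natl mulr2n; apply: le_trans (lerD D1 D3).
rewrite -[X in `|X|](subrKA (\prod_j geom (w j) M)).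
exact: ler_normD.
Qed.
End BoxSums.

(** * Lattice points of a simplicial cone *)

Section LatticeCombinations.
Set Implicit Arguments.
Unset Strict Implicit.
Context {R : realType} {a : vectType R} {r n : nat}.
Context (g : r.-tuple a) (hg : basis_of fullv g).
Context (lam : r.-tuple a) (hlam : zspan lam = lattice g).

Definition lat_comb (f : 'I_r -> nat) : a := \sum_j tnth lam j *+ f j.

Lemma zspan_mem k (v : k.-tuple a) j : zspan v (tnth v j).
Proof.
exists (fun i => (i == j)%:Z); rewrite (bigD1 j)//= eqxx mulr1z big1 ?addr0//.
by move=> i /negbTE ->; rewrite mulr0z.
Qed.

(** r vectors whose integral span contains a basis of the r-dimensional space. *)
Lemma basis_zspan : basis_of fullv lam.
Proof.
rewrite basisEdim size_tuple (vector.size_basis hg) leqnn andbT -(span_basis hg).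
apply/span_subvP => x /tnthP[j ->].
have : lattice g (tnth g j) by exact: zspan_mem.
rewrite -hlam => -[m ->]; apply: memv_suml => i _; apply: rpredMz.
exact: memv_span (mem_tnth _ _).
Qed.

Lemma lat_comb_lattice f : lattice g (lat_comb f).
Proof. by rewrite -hlam; exists (fun j => (f j)%:Z). Qed.

Lemma coord_comb (k : 'I_r -> R) j :
  coord lam j (\sum_i k i *: tnth lam i) = k j.
Proof.
under eq_bigr do rewrite (tnth_nth 0).
by rewrite coord_sum_free// (basis_free basis_zspan).
Qed.

Lemma lat_comb_inj f f' : lat_comb f = lat_comb f' -> f =1 f'.
Proof.
have E h : lat_comb h = \sum_i (h i)%:R *: tnth lam i.
  by apply: eq_bigr => i _; rewrite scaler_nat.
move=> /(congr1 (coord lam _)) ff j; have := ff j; rewrite !E !coord_comb.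
by move/eqP; rewrite eqr_nat => /eqP.
Qed.

(** Coordinates in a lattice basis are integers for a lattice point, and
    nonnegative for a point of the cone. *)
Lemma cone_lat_comb l : lattice g l -> ccone lam l -> exists f, l = lat_comb f.
Proof.
rewrite -hlam => -[m lm] [t t0 lt].
exists (fun j => `|m j|%N); rewrite lm; apply: eq_bigr => j _.
suff m0 : 0 <= m j by rewrite -{1}(gez0_abs m0) -pmulrn.
have := coord_comb t j; rewrite -lt lm.
have -> : \sum_i tnth lam i *~ m i = \sum_i (m i)%:~R *: tnth lam i.
  by apply: eq_bigr => i _; rewrite scaler_int.
by rewrite coord_comb => mt; rewrite -(ler0z R) mt.
Qed.

Context (alpha : n.-tuple 'Hom(a, R^o)) (halpha : zspan alpha = dual_lattice g).

(** The pairings <alpha_i, lambda_j> are integers, so taking their floors is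
    additive.  With y_i = alpha_i (u) this says that p_l is multiplicative in l,
    and with y = z that z^l is. *)
Lemma prod_floor_lat_comb (y : 'I_n -> R[i]) f : (forall i, y i != 0) ->
  \prod_i y i ^ Num.floor (tnth alpha i (lat_comb f) : R) =
  \prod_j (\prod_i y i ^ Num.floor (tnth alpha i (tnth lam j) : R)) ^+ f j.
Proof.
move=> y0; under [RHS]eq_bigr do rewrite -prodrXl.
rewrite exchange_big /=; apply: eq_bigr => i _.
have al_int v : lattice g v -> (tnth alpha i v : R) \is a Num.int.
  have : dual_lattice g (tnth alpha i).
    rewrite -halpha; exists (fun k => (k == i)%:Z).
    rewrite (bigD1 i)//= eqxx mulr1z big1 ?addr0//.
    by move=> k /negbTE ->; rewrite mulr0z.
  by apply.
have -> : Num.floor (tnth alpha i (lat_comb f) : R) =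
    \sum_j Num.floor (tnth alpha i (tnth lam j) : R) * (f j)%:Z.
  apply: (@intr_inj R); rewrite rmorph_sum /=.
  have /eqP -> : (Num.floor (tnth alpha i (lat_comb f) : R))%:~R ==
      (tnth alpha i (lat_comb f) : R).
    by rewrite -intrEfloor; apply: al_int; exact: lat_comb_lattice.
  rewrite linear_sum; apply: eq_bigr => j _; rewrite linearMn intrM.
  have /eqP -> : (Num.floor (tnth alpha i (tnth lam j) : R))%:~R ==
      (tnth alpha i (tnth lam j) : R).
    by rewrite -intrEfloor; apply: al_int; rewrite -hlam; exact: zspan_mem.
  by rewrite -pmulrn mulr_natr.
rewrite (big_morph (fun k : int => y i ^ k) (id1 := 1) (op1 := *%R)); first last.
- by rewrite expr0z.
- by move=> k k'; rewrite expfzDr.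
by apply: eq_bigr => j _; rewrite -exprz_exp.
Qed.
End LatticeCombinations.

(** * Summation of the generating series *)

Theorem proposition3p4 (R : realType) (a : vectType R) (r n : nat)
    (g : r.-tuple a) (hg : basis_of fullv g)
    (alpha : n.-tuple 'Hom(a, R^o))
    (halpha : zspan alpha = dual_lattice g)
    (hproj : projective alpha) (hspan : spanning alpha)
    (c : set (dual_top g)) (hc : chamber alpha c)
    (hkappa : closure c (kappa alpha))
    (P : {mpoly R[i][n]})
    (hP : P \is (n - r)%N.-homog)
    (Z : cchain a r) (hZ : hclass alpha c Z)
    (hZsupp : carrier Z `<=` Ucompl alpha `&` kappa_disc alpha)
    (lam : r.-tuple a) (hlam : positive_basis alpha c lam)
    (z : 'I_n -> R[i]) (hz : forall i, z i != 0)
    (hq : forall j u, carrier Z u ->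
      `|zmon alpha z (tnth lam j)| < `|pfun alpha (tnth lam j) u|) :
  has_sum (lattice g `&` polar c)
    (fun l => bracket alpha c P l * zmon alpha z l)
    (period g
      (fun u => evalP alpha P u * \prod_j pfun alpha (tnth lam j) u /
        ((1 - cform (kappa alpha) u) * \prod_i cform (tnth alpha i) u *
         \prod_j (pfun alpha (tnth lam j) u - zmon alpha z (tnth lam j))))
      Z).
Proof.
have [J hJ JZ] : exists2 J, is_JK alpha c J &
    forall Z', hclass alpha c Z' -> (forall x, x \in Z' -> C1_cube x.2) /\
      forall f, ratA g alpha f -> J f = period g f Z'.
  have [h hh] : exists h, is_hclass alpha c h.
    apply: contrapT => nh; move: hZ; rewrite /hclass xgetPN// => h hh.
    by apply: nh; exists h.
  have [[Z0 _ hE] [J hJ JE]] := xgetPex set0 (ex_intro _ h hh).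
  exists J => // Z' hZ'; split; last by move=> f; exact: JE.
  by have := hZ'; rewrite /hclass hE => -[[[]]].
have [C1Z JZ'] := JZ Z hZ.
have bracketE l : bracket alpha c P l = period g (bracket_form alpha P l) Z.
  have [hx sx] := @xgetPex _ [::] [set Z | admissible_cycle alpha c Z]
    (ex_intro _ Z (conj hZ hZsupp)).
  have [C1x Jx] := JZ _ hx.
  by rewrite -(period_bracket_unique hg P l C1x C1Z sx hZsupp Jx JZ').
have bracket0 l : ~ polar c l -> bracket alpha c P l = 0.
  by rewrite bracketE; exact: (period_bracket0 hg P hJ C1Z hZsupp JZ').
have [lamE lam_cone _] := hlam.
pose p j u := pfun alpha (tnth lam j) u.
pose q j := zmon alpha z (tnth lam j).
pose w j u := q j / p j u.
pose H u := evalP alpha P u /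
  ((1 - cform (kappa alpha) u) * \prod_i cform (tnth alpha i) u).
have p0 j u : carrier Z u -> p j u != 0.
  by move=> /hZsupp[Uu _]; exact: pfun_neq0.
have cp j : chain_cont Z (p j) by exact: chain_cont_pfun.
have cw j : chain_cont Z (w j).
  by apply: chain_contM; [exact: chain_contC | apply: chain_contV => // u /p0].
have w_lt1 j u : carrier Z u -> `|w j u| < 1.
  move=> Zu; rewrite normrM normfV ltr_pdivrMr ?normr_gt0 ?p0// mul1r.
  exact: hq.
have w1 j u : carrier Z u -> 1 - w j u != 0.
  move=> Zu; rewrite subr_eq0; apply: contraTneq (w_lt1 j u Zu) => <-.
  by rewrite normr1 ltxx.
have cH : chain_cont Z H.
  apply: chain_contM; first exact: chain_cont_evalP.
  apply: (@chain_contV _ _ _ _ (fun u =>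
    (1 - cform (kappa alpha) u) * \prod_i cform (tnth alpha i) u)).
    move=> u Zu; have [Uu _] := hZsupp _ Zu.
    by rewrite mulf_neq0 ?prod_form_neq0// (one_sub_kappa_neq0 hZsupp).
  apply: chain_contM.
    by apply: chain_contB; [exact: chain_contC | exact: chain_cont_cform].
  by apply: chain_cont_prod => i; exact: chain_cont_cform.
have /choice[rh rhP] j : exists rho : R, [/\ 0 <= rho, rho < 1 &
    forall u, carrier Z u -> `|w j u| <= rho%:C].
  have [rho rho0 [rhoM rho1]] := chain_cont_bound (cw j).
  by exists rho; split=> //; apply: rho1 => // u /w_lt1.
pose rho := \big[Num.max/0]_j rh j.
have rho0 : 0 <= rho by exact: bigmax_ge_id.
have rho1 : rho < 1 by apply: bigmax_lt => // j _; have [] := rhP j.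
have rhoM j u : carrier Z u -> `|w j u| <= rho%:C.
  move=> Zu; have [_ _ /(_ u Zu) h] := rhP j; apply: le_trans h _.
  by rewrite lecR; exact: le_bigmax.
have [B B0 [BM _]] := chain_cont_bound cH.
have [K K0 KP] := period_bound g C1Z.
move=> eps eps0.
pose b := (1 - rho)^-1.
have b0 : 0 <= b by rewrite invr_ge0 subr_ge0 ltW.
(* K * B times the error of box_sum_approx for the box of side N is below eps. *)
have [N HN] := expr_small (K * (B * (2 * (r%:R * (b ^+ r * b))))) rho0 rho1 eps0.
pose comb M (f : {ffun 'I_r -> 'I_M}) := lat_comb lam (fun j => f j).
exists [fset x in [seq x <- [seq comb N f | f : {ffun 'I_r -> 'I_N}]
                     | `[< polar c x >]]]%fset.
  move=> l; rewrite !inE mem_filter => /andP[/asboolP pl /mapP[f _ lE]].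
  by split=> //; rewrite lE; exact: lat_comb_lattice.
move=> F F0F FD.
(* Exponents phi l of the points l of F, and a box, of side M at least N, that
   contains all of them. *)
have /choice[phi phiP] l : exists f, l \in F -> l = lat_comb lam f.
  have [/FD[ll pl]|] := boolP (l \in F); last by exists (fun=> 0%N).
  by have [f ->] := cone_lat_comb hg lamE ll (lam_cone _ pl); exists f.
pose M := maxn N (\max_(l <- F) \max_j phi l j).+1.
have NM : (N <= M)%N by exact: leq_maxl.
pose A (f : {ffun 'I_r -> 'I_M}) := (comb M f \in F) || [forall j, (f j < N)%N].
pose T l := bracket alpha c P l * zmon alpha z l.
have combI : injective (comb M).
  by move=> f f' /(lat_comb_inj hg lamE) ff; apply/ffunP => j; exact/val_inj/ff.
(* The exponents outside F of the box of side N contribute 0: such a point is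
   not in the polar cone, since the starting set contains those that are. *)
have sumF : \sum_(l <- F) T l = \sum_(f | A f) T (comb M f).
  rewrite (bigID (fun f => comb M f \in F)) /= [X in _ = _ + X]big1 ?addr0; last first.
    move=> f /andP[+ fF]; rewrite /A (negbTE fF) /= => /forallP fN.
    rewrite /T bracket0 ?mul0r// => pf; move/negP: fF; apply; apply: F0F.
    rewrite !inE mem_filter; apply/andP; split; first exact/asboolP.
    apply/mapP; exists [ffun j => Ordinal (fN j)]; first by rewrite mem_enum.
    by rewrite /comb /lat_comb; apply: eq_bigr => j _; rewrite ffunE.
  rewrite (eq_bigl (fun f => comb M f \in F)); last first.
    by move=> f; rewrite /A; case: (_ \in F) => //; rewrite andbF.
  rewrite -[RHS]big_filter -[RHS](big_map (comb M) xpredT T).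
  apply: perm_big; apply: uniq_perm; first exact: fset_uniq.
    by rewrite map_inj_uniq// filter_uniq// index_enum_uniq.
  move=> l; apply/idP/mapP => [lF|[f + ->]]; last by rewrite mem_filter => /andP[].
  have phiM j : (phi l j < M)%N.
    rewrite leq_max; apply/orP; right; rewrite ltnS.
    apply: leq_trans (leq_bigmax_seq (F := fun l => \max_j phi l j) l lF isT).
    exact: leq_bigmax.
  have lE : l = comb M [ffun j => Ordinal (phiM j)].
    rewrite [LHS](phiP l lF) /comb /lat_comb.
    by apply: eq_bigr => j _; rewrite ffunE.
  exists [ffun j => Ordinal (phiM j)] => //.
  by rewrite mem_filter mem_index_enum -lE lF.
rewrite [X in `|X - _|]sumF.
have cb l := chain_cont_bracket_form P C1Z hZsupp l.
have -> : \sum_(f | A f) T (comb M f) = period g (fun u =>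
    \sum_(f | A f) zmon alpha z (comb M f) * bracket_form alpha P (comb M f) u) Z.
  rewrite (@period_sum _ _ _ g Z C1Z _ _ A _ (fun f => bracket_form alpha P (comb M f)))//.
  by apply: eq_bigr => f _; rewrite /T mulrC bracketE.
have box_term f u : carrier Z u ->
    zmon alpha z (comb M f) * bracket_form alpha P (comb M f) u =
    H u * \prod_j w j u ^+ f j.
  move=> Zu; have [Uu _] := hZsupp _ Zu.
  rewrite /bracket_form /pfun /zmon !(prod_floor_lat_comb lamE halpha)//.
  under [in RHS]eq_bigr do rewrite exprMn exprVn.
  rewrite big_split /= prodfV /H.
  have pp : \prod_j p j u ^+ f j != 0.
    by apply/prodf_neq0 => j _; rewrite expf_neq0 ?p0.
  have := pp; have := prod_form_neq0 Uu; have := one_sub_kappa_neq0 hZsupp Zu.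
  rewrite /p /pfun.
  set k1 := 1 - _; set X := \prod_i cform _ _; set Y := \prod_j (_ ^+ _ : R[i]).
  set W := \prod_j (_ ^+ _ : R[i]).
  by move=> k0 X0 Y0; field; rewrite k0 X0 Y0.
have closed_form u : carrier Z u ->
    evalP alpha P u * \prod_j pfun alpha (tnth lam j) u /
        ((1 - cform (kappa alpha) u) * \prod_i cform (tnth alpha i) u *
         \prod_j (pfun alpha (tnth lam j) u - zmon alpha z (tnth lam j))) =
    H u * \prod_j (1 - w j u)^-1.
  move=> Zu.
  have -> : \prod_j (1 - w j u)^-1 = \prod_j p j u / \prod_j (p j u - q j).
    rewrite -prodf_div; apply: eq_bigr => j _.
    by rewrite -invf_div mulrBl divff ?p0.
  by rewrite /H invfM mulrACA !mulrA.
have cG : chain_cont Z (fun u => H u * \prod_j (1 - w j u)^-1).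
  apply: chain_contM => //; apply: chain_cont_prod => j.
  apply: (@chain_contV _ _ _ _ (fun u => 1 - w j u)); first by move=> u; exact: w1.
  by apply: chain_contB => //; exact: chain_contC.
have cS : chain_cont Z (fun u => H u * \sum_(f | A f) \prod_j w j u ^+ f j).
  apply: chain_contM => //; apply: chain_cont_sum => f; apply: chain_cont_prod => j.
  exact: chain_contX.
rewrite distrC (period_ext g closed_form).
rewrite [X in `|_ - X|](@period_ext _ _ _ g Z _
  (fun u => H u * \sum_(f | A f) \prod_j w j u ^+ f j)); last first.
  by move=> u Zu; rewrite mulr_sumr; apply: eq_bigr => f _; exact: box_term.
rewrite addrC -mulN1r -period_lin//.
apply: le_lt_trans (_ : _ <= (K * (B * (2 * (r%:R * (b ^+ r * (rho ^+ N * b))))))%:C) _.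
  apply: KP.
  - by rewrite !mulr_ge0 ?exprn_ge0.
  - by apply: chain_contD => //; apply: chain_contM => //; exact: chain_contC.
  move=> u Zu; rewrite mulN1r addrC -mulrBr normrM rmorphM /=.
  apply: ler_pM => //; first exact: BM.
  have rc0 : 0 <= rho%:C by rewrite ler0c.
  have rc1 : rho%:C < 1 by rewrite -[1]/(1%:C) ltcR.
  have := box_sum_approx rc0 rc1 NM (fun j => rhoM j u Zu) (A := A).
  rewrite !(rmorphM, rmorphXn, rmorph_nat) /= /b fmorphV rmorphB rmorph1.
  by apply => f fN; apply/orP; right; apply/forallP.
rewrite ltcR; apply: le_lt_trans HN.
rewrite le_eqVlt; apply/orP; left; apply/eqP; ring.
Qed.
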